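(* Let \(w_2, w_3\) be integers with \(1 \leq w_2 \leq w_3\), and let \(\mathcal{T}_{1,w_2,w_3}\) be the set of lattice tetrahedra in \(\mathbb{R}^3\) with multi-width \((1,w_2,w_3)\), taken up to affine unimodular equivalence. Then the map sending a tetrahedron \(T \in \mathcal{S}_{1,w_2,w_3}\) (defined in the context) to its affine equivalence class is a bijection \(\mathcal{S}_{1,w_2,w_3} \to \mathcal{T}_{1,w_2,w_3}\). In particular, \[ |\mathcal{T}_{1,w_2,w_3}| = \begin{cases} 2w_2^2 + 4 & \text{if \(w_2\) and \(w_3\) are even}\\ 2w_2^2 + 3 & \text{if \(w_2\) is even and \(w_3\) is odd}\\ 2w_2^2 + 2 & \text{if \(w_2\) is odd} \end{cases} \] when \(w_3 > w_2 > 1\); \[ |\mathcal{T}_{1,w_2,w_2}| = \begin{cases} w_2^2 + w_2 + 2 & \text{if \(w_2\) is even}\\ w_2^2 + w_2 + 1 & \text{if \(w_2\) is odd} \end{cases} \] when \(w_3 = w_2 > 1\); \(|\mathcal{T}_{1,1,w_3}| = 3\) when \(w_3 > w_2 = 1\); and \(|\mathcal{T}_{1,1,1}| = 2\).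
   Context: A lattice polytope in \(\mathbb{R}^d\) is the convex hull of finitely many points of \(\mathbb{Z}^d\). Two lattice polytopes (or multisets of lattice points) are affine (unimodularly) equivalent if one is mapped onto the other by a map \(x \mapsto Ax + b\) with \(A \in \mathrm{GL}_d(\mathbb{Z})\), \(b \in \mathbb{Z}^d\). For a lattice polytope \(P\) and a dual vector \(u \in (\mathbb{Z}^d)^*\), \(\mathrm{width}_u(P) = \max_{x\in P} u\cdot x - \min_{x \in P} u \cdot x\). The multi-width \(\mathrm{mwidth}(P)\) is the lexicographically minimal tuple \((\mathrm{width}_{u_1}(P),\dots,\mathrm{width}_{u_d}(P))\) over all linearly independent \(u_1,\dots,u_d \in (\mathbb{Z}^d)^*\). For an integer \(n\) and positive integer \(a\), \((n \bmod a)\) denotes the residue in \(\{0,\dots,a-1\}\); \(0\) denotes the origin. Triangle set: for integers \(0 < a \leq b\), \(\mathcal{S}_{a,b}\) is the set of lattice triangles in \(\mathbb{R}^2\) equal to one of: (i) \(\mathrm{conv}(0,(a,y_1),(0,b))\) with \(y_1 \geq 0\) an integer and \(y_1 \leq (b - y_1 \bmod a)\); (ii) \(\mathrm{conv}(0,(a,y_1),(x_2,b))\) with integers \(0 < x_2 \leq a/2\), \(0 \leq y_1 \leq a - x_2\), and additionally \(y_1 \geq x_2\) if \(a = b\); (iii) \(\mathrm{conv}((0,y_0),(a,0),(x_2,b))\) with integers \(1 < x_2 < a/2\), \(0 < y_0 < x_2\), only when \(a < b\). The set \(\mathcal{S}_{1,w_2,w_3}\): when \(w_3 \geq w_2 >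 1\) it consists of the tetrahedra (all parameters integers) (1) \(\mathrm{conv}(\{0\}\times t, (1,0,0))\) with \(t \in \mathcal{S}_{w_2,w_3}\); (2) \(\mathrm{conv}(0,(0,w_2,z_1),(1,0,0),(1,0,w_3))\) with \(0 \leq z_1 \leq w_2/2\); (3) \(\mathrm{conv}(0,(0,w_2,z_1),(1,0,w_3),(1,y_1,0))\) with \(0 < y_1 \leq w_2\) and \(w_3 - w_2 \leq z_1 \leq w_3\); (4) \(\mathrm{conv}(0,(0,w_2,w_3),(1,0,w_3),(1,y_1,z_1))\) with \(0 < z_1 < y_1 < w_2\); where if \(w_3 = w_2\) one additionally requires \(y_1 \leq z_1\) in (3) and \(z_1 \leq w_2 - y_1\) in (4). When \(w_3 > w_2 = 1\), \(\mathcal{S}_{1,1,w_3} = \{\mathrm{conv}(0,(0,1,0),(0,0,w_3),(1,0,0)),\ \mathrm{conv}(0,(0,1,w_3-1),(1,0,w_3),(1,1,0)),\ \mathrm{conv}(0,(0,1,w_3),(1,0,w_3),(1,1,0))\}\). Finally \(\mathcal{S}_{1,1,1} = \{\mathrm{conv}(0,(1,0,0),(0,1,0),(0,0,1)),\ \mathrm{conv}(0,(0,1,1),(1,0,1),(1,1,0))\}\). *)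

(* Defs.v *)
From mathcomp Require Import all_boot all_order all_algebra.
From mathcomp Require Import all_classical all_reals all_analysis.

Set Implicit Arguments.
Unset Strict Implicit.
Unset Printing Implicit Defensive.

Import Order.TTheory GRing.Theory Num.Theory.
Local Open Scope classical_set_scope.
Local Open Scope ring_scope.

(* Points of R^d are column vectors and dual vectors are row vectors, so that
   the affine maps are [x |-> A *m x + b] and the pairing is [u *m x]. *)

Definition intmx (R : realType) (m n : nat) (A : 'M[int]_(m, n)) : 'M[R]_(m, n) :=
  map_mx intr A.
Arguments intmx R {m n} A.

Definition convex_hull (R : realType) (d : nat) (A : set 'cV[R]_d) : set 'cV[R]_d :=
  smallest (@convex_set R 'cV[R]_d) A.

Definition affinely_independent (R : realType) (d n : nat) (p : 'I_n -> 'cV[R]_d) :=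
  forall c : 'I_n -> R,
    \sum_(i < n) c i = 0 -> \sum_(i < n) c i *: p i = 0 -> forall i, c i = 0.

Definition lattice_simplex (R : realType) (d n : nat) (P : set 'cV[R]_d) :=
  exists v : 'I_n.+1 -> 'cV[int]_d,
    affinely_independent (fun i => intmx R (v i)) /\
    P = convex_hull (range (fun i => intmx R (v i))).

Definition lattice_tetrahedron (R : realType) (P : set 'cV[R]_3) :=
  lattice_simplex 3 P.

Definition affine_equiv (R : realType) (d : nat) (P Q : set 'cV[R]_d) :=
  exists (A : 'M[int]_d) (b : 'cV[int]_d),
    A \in unitmx /\ Q = [set intmx R A *m x + intmx R b | x in P].

Definition affine_class (R : realType) (d : nat) (P : set 'cV[R]_d) :
    set (set 'cV[R]_d) :=
  [set Q | affine_equiv P Q].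

(* On a nonempty compact set, in particular on a polytope, the supremum and
   the infimum are the maximum and the minimum. *)
Definition width (R : realType) (d : nat) (u : 'rV[int]_d) (P : set 'cV[R]_d) : R :=
  let values := [set (intmx R u *m x) 0 0 | x in P] in
  sup values - inf values.

Definition widths (R : realType) (d : nat) (U : 'M[int]_d) (P : set 'cV[R]_d) :
    d.-tuple R :=
  [tuple width (row i U) P | i < d].

(* The candidate dual vectors [u_1, ..., u_d] are the rows of [U]. *)
Definition is_mwidth (R : realType) (d : nat) (P : set 'cV[R]_d) (w : d.-tuple R) :=
  (exists2 U : 'M[int]_d, row_free (intmx R U) & w = widths U P) /\
  (forall U : 'M[int]_d, row_free (intmx R U) ->
    ((w : d.-tuplelexi R) <= (widths U P : d.-tuplelexi R))%O).

Definition pt2 (R : realType) (x y : int) : 'cV[R]_2 :=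
  intmx R (\col_i [:: x; y]`_i).

Definition pt3 (R : realType) (x y z : int) : 'cV[R]_3 :=
  intmx R (\col_i [:: x; y; z]`_i).

(* The set S_{a,b}, for 0 < a <= b. *)
Definition triangles (R : realType) (a b : int) : set (set 'cV[R]_2) :=
  [set t | exists y1 : int,
    0 <= y1 <= ((b - y1) %% a)%Z /\
    t = convex_hull [set pt2 R 0 0; pt2 R a y1; pt2 R 0 b]] `|`
  [set t | exists x2 y1 : int,
    [/\ 0 < x2, 2 * x2 <= a, 0 <= y1 <= a - x2, (a = b -> x2 <= y1) &
    t = convex_hull [set pt2 R 0 0; pt2 R a y1; pt2 R x2 b]]] `|`
  [set t | exists x2 y0 : int,
    [/\ a < b, 1 < x2, 2 * x2 < a, 0 < y0 < x2 &
    t = convex_hull [set pt2 R 0 y0; pt2 R a 0; pt2 R x2 b]]].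
Arguments triangles R a b : clear implicits.

Definition at_height0 (R : realType) (t : set 'cV[R]_2) : set 'cV[R]_3 :=
  [set (col_mx (0 : 'cV[R]_1) x : 'cV[R]_3) | x in t].

(* The set S_{1,w2,w3}, for 1 <= w2 <= w3. *)
Definition tetrahedra (R : realType) (w2 w3 : int) : set (set 'cV[R]_3) :=
  if 1 < w2 then
    [set T | exists t : set 'cV[R]_2,
      triangles R w2 w3 t /\
      T = convex_hull (at_height0 t `|` [set pt3 R 1 0 0])] `|`
    [set T | exists z1 : int,
      [/\ 0 <= z1, 2 * z1 <= w2 &
      T = convex_hull
        [set pt3 R 0 0 0; pt3 R 0 w2 z1; pt3 R 1 0 0; pt3 R 1 0 w3]]] `|`
    [set T | exists y1 z1 : int,
      [/\ 0 < y1 <= w2, w3 - w2 <= z1 <= w3, (w3 = w2 -> y1 <= z1) &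
      T = convex_hull
        [set pt3 R 0 0 0; pt3 R 0 w2 z1; pt3 R 1 0 w3; pt3 R 1 y1 0]]] `|`
    [set T | exists y1 z1 : int,
      [/\ 0 < z1, z1 < y1, y1 < w2, (w3 = w2 -> z1 <= w2 - y1) &
      T = convex_hull
        [set pt3 R 0 0 0; pt3 R 0 w2 w3; pt3 R 1 0 w3; pt3 R 1 y1 z1]]]
  else if 1 < w3 then
    [set convex_hull
       [set pt3 R 0 0 0; pt3 R 0 1 0; pt3 R 0 0 w3; pt3 R 1 0 0];
     convex_hull
       [set pt3 R 0 0 0; pt3 R 0 1 (w3 - 1); pt3 R 1 0 w3; pt3 R 1 1 0];
     convex_hull
       [set pt3 R 0 0 0; pt3 R 0 1 w3; pt3 R 1 0 w3; pt3 R 1 1 0]]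
  else
    [set convex_hull
       [set pt3 R 0 0 0; pt3 R 1 0 0; pt3 R 0 1 0; pt3 R 0 0 1];
     convex_hull
       [set pt3 R 0 0 0; pt3 R 0 1 1; pt3 R 1 0 1; pt3 R 1 1 0]].
Arguments tetrahedra R w2 w3 : clear implicits.

(* The set T_{1,w2,w3} of equivalence classes. *)
Definition tetrahedron_classes (R : realType) (w2 w3 : nat) :
    set (set (set 'cV[R]_3)) :=
  [set affine_class P | P in
    [set P : set 'cV[R]_3 |
      lattice_tetrahedron P /\ is_mwidth P [tuple 1; w2%:R; w3%:R]]].
Arguments tetrahedron_classes R w2 w3 : clear implicits.

(* Main.v *)
Require Import Defs.
From mathcomp Require Import all_boot all_order all_algebra all_fingroup.
From mathcomp Require Import all_classical all_reals all_analysis.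
From mathcomp Require Import zify ring lra.

(* A width-one tetrahedron has its vertices on two adjacent lattice planes,
   three on one plane and one on the other, or two on each. Up to equivalence
   it is determined by the two difference vectors of the triangle, respectively
   by the directions of the two edges, i.e. by a 2 x 2 integer matrix up to
   GL_2(Z) on the left and, on the right, the symmetries of the triangle or the
   signed permutations. The width of a functional that is not a multiple of the
   first coordinate is, after the best shear, the norm [hnorm] of the
   corresponding combination of the rows, so the multi-width is (1, w2, w3)
   exactly when the rows can be chosen Gauss-reduced with norms w2 <= w3.
   Reduced pairs are brought to the listed normal forms by cases; for
   uniqueness, the rows of an equivalent normal form are short combinations of
   the given ones, which leaves finitely many linear systems. For w2 = 1 the
   first coordinate is no longer distinguished, but the volume separates the
   representatives. *)

Set Implicit Arguments.
Unset Strict Implicit.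
Unset Printing Implicit Defensive.

Import Order.TTheory GRing.Theory Num.Theory.
Local Open Scope classical_set_scope.
Local Open Scope ring_scope.

(** * Convex hulls and widths of lattice polytopes *)

Section ConvexHull.
Variable R : realType.

(** Two passages carry the weight. An affine equivalence is only an equality of point sets, so the
    vertices must be recovered from the hull before any matrix can be compared; this is done by
    separating functionals, and nondegeneracy turns the result into a permutation. For [1 < w2] the
    height is then preserved up to sign, since a functional that involves the other coordinates has
    width at least [w2], whereas the height of the image has width at most one. What remains is
    arithmetic that would be linear but for products of an unknown row coefficient with a parameter.
    For [w2 < w3] the first row of an equivalent form cannot involve the second, and one unknown
    multiple survives; for [w2 = w3] the rows may mix, and all four coefficients are first confined
    to -1, 0, 1. The tie-breaking inequalities in the lists for [w2 = w3], and the residue condition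
    in the family with [x = 0], select one member from each orbit of the remaining symmetries.
    Everything is indexed by triples [(k, x, y)], so injectivity and counting become statements
    about integers. *)

Definition affmap d e (M : 'M[R]_(e, d)) (b : 'cV[R]_e) (x : 'cV[R]_d) : 'cV[R]_e :=
  M *m x + b.

Lemma convE d (x y : convex_lmodType 'cV[R]_d) (t : {i01 R}) :
  conv t x y = t%:num *: (x : 'cV[R]_d) + (1 - t%:num) *: (y : 'cV[R]_d).
Proof. by []. Qed.

Lemma affmap_conv d e M b (x y : 'cV[R]_d) (t : {i01 R}) :
  @affmap d e M b (conv t (x : convex_lmodType _) (y : convex_lmodType _)) =
  conv t (affmap M b x : convex_lmodType 'cV[R]_e) (affmap M b y : convex_lmodType _).
Proof.
rewrite /affmap !convE mulmxDr -!scalemxAr !scalerDr addrACA -scalerDl.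
by rewrite subrKC scale1r.
Qed.

Lemma convex_hull_min d (A C : set 'cV[R]_d) :
  convex_set (C : set (convex_lmodType _)) -> A `<=` C -> convex_hull A `<=` C.
Proof. exact: smallest_sub. Qed.

Lemma convex_hull_sub d (A : set 'cV[R]_d) : A `<=` convex_hull A.
Proof. exact: sub_gen_smallest. Qed.

Lemma convex_hull_convex d (A : set 'cV[R]_d) :
  convex_set (convex_hull A : set (convex_lmodType _)).
Proof.
move=> x y t /set_mem hx /set_mem hy; apply/mem_set => C [cC AC].
by apply/set_mem/cC; apply/mem_set; [apply: hx|apply: hy].
Qed.

Lemma convex_preimage d e (M : 'M[R]_(e, d)) b (C : set 'cV[R]_e) :
  convex_set (C : set (convex_lmodType _)) ->
  convex_set (affmap M b @^-1` C : set (convex_lmodType _)).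
Proof.
move=> cC x y t /set_mem hx /set_mem hy; apply/mem_set => /=.
rewrite affmap_conv; apply/set_mem/cC; exact/mem_set.
Qed.

Lemma convex_image d e (M : 'M[R]_(e, d)) b (C : set 'cV[R]_d) :
  convex_set (C : set (convex_lmodType _)) ->
  convex_set (affmap M b @` C : set (convex_lmodType _)).
Proof.
move=> cC _ _ t /set_mem[x hx <-] /set_mem[y hy <-]; apply/mem_set => /=.
rewrite -affmap_conv; exists (conv t (x : convex_lmodType _) (y : convex_lmodType _)) => //.
by apply/set_mem/cC; exact/mem_set.
Qed.

Lemma convex_hull_image d e (M : 'M[R]_(e, d)) b (A : set 'cV[R]_d) :
  affmap M b @` convex_hull A = convex_hull (affmap M b @` A).
Proof.
apply/seteqP; split.
  move=> _ [x hx <-]; move: x hx; apply: convex_hull_min.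
    by apply: convex_preimage; exact: convex_hull_convex.
  by move=> x Ax; apply: convex_hull_sub; exists x.
apply: convex_hull_min; first by apply: convex_image; exact: convex_hull_convex.
by apply: image_subset; exact: convex_hull_sub.
Qed.

Lemma convex_slab d (u : 'rV[R]_d) (lo hi : R) :
  convex_set ([set x : 'cV[R]_d | lo <= (u *m x) 0 0 <= hi] : set (convex_lmodType _)).
Proof.
move=> x y t /set_mem /= /andP[hx1 hx2] /set_mem /= /andP[hy1 hy2]; apply/mem_set => /=.
rewrite convE mulmxDr -!scalemxAr mxE [X in X + _]mxE [X in _ + X]mxE.
move: ((u *m x) 0 0) ((u *m y) 0 0) hx1 hx2 hy1 hy2 => p q hx1 hx2 hy1 hy2.
have t0 : 0 <= t%:num by [].
have t1 : t%:num <= 1 by [].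
by apply/andP; split; nra.
Qed.

(** Serves the pyramids, which are hulls of an apex together with a triangle that is itself a
    hull. *)
Lemma convex_hullU d (A B : set 'cV[R]_d) :
  convex_hull (convex_hull A `|` B) = convex_hull (A `|` B).
Proof.
apply/seteqP; split; apply: convex_hull_min.
- exact: convex_hull_convex.
- move=> x [|Bx]; last by apply: convex_hull_sub; right.
  move: x; apply: convex_hull_min; first exact: convex_hull_convex.
  by move=> x Ax; apply: convex_hull_sub; left.
- exact: convex_hull_convex.
- move=> x [Ax|Bx]; apply: convex_hull_sub; [left|right] => //.
  exact: convex_hull_sub.
Qed.

End ConvexHull.

(** * Lattice hulls, their widths, and affine equivalence *)

Section Lattice.
Variable R : realType.

Lemma intmxM m n p (A : 'M[int]_(m, n)) (B : 'M[int]_(n, p)) :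
  intmx R (A *m B) = intmx R A *m intmx R B.
Proof. exact: map_mxM. Qed.

Lemma intmxD m n (A B : 'M[int]_(m, n)) : intmx R (A + B) = intmx R A + intmx R B.
Proof. exact: map_mxD. Qed.

Lemma intmx1 n : intmx R (1%:M : 'M[int]_n) = 1%:M.
Proof. exact: map_mx1. Qed.

Lemma intmx_inj m n : injective (@intmx R m n).
Proof.
by move=> A B /matrixP AB; apply/matrixP => i j; have := AB i j; rewrite !mxE => /intr_inj.
Qed.

Definition lhull d n (v : 'I_n -> 'cV[int]_d) : set 'cV[R]_d :=
  convex_hull (range (fun i => intmx R (v i))).

Definition dual d (u : 'rV[int]_d) (x : 'cV[int]_d) : int := (u *m x) 0 0.

Lemma dualE d (u : 'rV[int]_d) (x : 'cV[int]_d) :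
  (intmx R u *m intmx R x) 0 0 = (dual u x)%:~R.
Proof. by rewrite -intmxM mxE. Qed.

(** A slab that contains the vertices is convex, hence contains the hull, so the supremum and the
    infimum are attained at vertices. Real widths thus become integer differences between two
    vertices. *)
Lemma lhull_width d n (u : 'rV[int]_d) (v : 'I_n.+1 -> 'cV[int]_d) :
  exists i j, (forall k l, dual u (v k) - dual u (v l) <= dual u (v i) - dual u (v j)) /\
    width u (lhull v) = (dual u (v i) - dual u (v j))%:~R.
Proof.
have [i _ hi] := @Order.TotalTheory.arg_maxP _ int 'I_n.+1 ord0 xpredT (fun i => dual u (v i)) isT.
have [j _ hj] := @Order.TotalTheory.arg_minP _ int 'I_n.+1 ord0 xpredT (fun i => dual u (v i)) isT.
exists i, j; split; first by move=> k l; have := hi k isT; have := hj l isT; lia.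
have slab x : lhull v x -> (dual u (v j))%:~R <= (intmx R u *m x) 0 0 <= (dual u (v i))%:~R.
  move: x; apply: convex_hull_min; first exact: convex_slab.
  by move=> _ [k _ <-] /=; rewrite dualE !ler_int; apply/andP; split; [exact: hj|exact: hi].
rewrite /width intrB; set V := [set _ | _ in _].
have Vv k : V (dual u (v k))%:~R.
  by exists (intmx R (v k)); [apply: convex_hull_sub; exists k|rewrite dualE].
have Vub : ubound V (dual u (v i))%:~R by move=> _ [x /slab/andP[_ h] <-].
have Vlb : lbound V (dual u (v j))%:~R by move=> _ [x /slab/andP[h _] <-].
congr (_ - _); apply/eqP; rewrite eq_le; apply/andP; split.
- by apply: ge_sup => //; exists (dual u (v i))%:~R.
- by apply: ub_le_sup => //; exists (dual u (v i))%:~R.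
- by apply: ge_inf => //; exists (dual u (v j))%:~R.
- by apply: lb_le_inf => //; exists (dual u (v j))%:~R.
Qed.

Lemma affmap_lhull d n (A : 'M[int]_d) b (v : 'I_n -> 'cV[int]_d) :
  affmap (intmx R A) (intmx R b) @` lhull v = lhull (fun i => A *m v i + b).
Proof.
rewrite /lhull convex_hull_image; congr convex_hull; apply/seteqP; split.
  by move=> _ [_ [i _ <-] <-]; exists i => //; rewrite intmxD intmxM.
by move=> _ [i _ <-]; exists (intmx R (v i)); [exists i|rewrite intmxD intmxM].
Qed.

Lemma affine_equiv_lhull d n (A : 'M[int]_d) b (v : 'I_n -> 'cV[int]_d) :
  A \in unitmx -> affine_equiv (lhull v) (lhull (fun i => A *m v i + b)).
Proof. by move=> uA; exists A, b; split => //; rewrite -affmap_lhull. Qed.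

Lemma affine_equiv_refl d (P : set 'cV[R]_d) : affine_equiv P P.
Proof.
exists 1%:M, 0; split; first exact: unitmx1.
rewrite intmx1 /intmx map_mx0; apply/seteqP; split => [x Px|_ [x Px <-]].
  by exists x => //; rewrite mul1mx addr0.
by rewrite mul1mx addr0.
Qed.

Lemma affine_equiv_trans d (P Q S : set 'cV[R]_d) :
  affine_equiv P Q -> affine_equiv Q S -> affine_equiv P S.
Proof.
move=> [A [b [uA ->]]] [B [c [uB ->]]]; exists (B *m A), (B *m b + c).
rewrite unitmx_mul uA uB; split => //; apply/seteqP; split.
  move=> _ [_ [x Px <-] <-]; exists x => //.
  by rewrite intmxM intmxD intmxM mulmxDr mulmxA addrA.
move=> _ [x Px <-]; exists (intmx R A *m x + intmx R b); first by exists x.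
by rewrite intmxM intmxD intmxM mulmxDr mulmxA addrA.
Qed.

Lemma affine_equiv_sym d (P Q : set 'cV[R]_d) :
  affine_equiv P Q -> affine_equiv Q P.
Proof.
move=> [A [b [uA ->]]]; exists (invmx A), (- (invmx A *m b)).
rewrite unitmx_inv; split => //.
have cancel x : intmx R (invmx A) *m (intmx R A *m x + intmx R b) +
    intmx R (- (invmx A *m b)) = x.
  rewrite mulmxDr mulmxA -!intmxM mulVmx // intmx1 mul1mx -addrA -intmxD subrr.
  by rewrite /intmx map_mx0 addr0.
apply/seteqP; split => [x Px|_ [_ [x Px <-] <-]]; last by rewrite cancel.
by exists (intmx R A *m x + intmx R b); [exists x|rewrite cancel].
Qed.

Lemma affine_class_eqP d (P Q : set 'cV[R]_d) :
  affine_class P = affine_class Q <-> affine_equiv P Q.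
Proof.
split=> [PQ|PQ].
  by have : affine_class Q Q := affine_equiv_refl Q; rewrite -PQ.
apply/seteqP; split => S /= h; last exact: affine_equiv_trans h.
exact: affine_equiv_trans (affine_equiv_sym PQ) h.
Qed.

Lemma width_affine d n (A : 'M[int]_d) b u (v : 'I_n.+1 -> 'cV[int]_d) :
  width u (lhull (fun i => A *m v i + b)) = width (u *m A) (lhull v).
Proof.
have [i [j [hij ->]]] := lhull_width u (fun i => A *m v i + b).
have [k [l [hkl ->]]] := lhull_width (u *m A) v.
have dualA x y : dual u (A *m x + b) - dual u (A *m y + b) =
    dual (u *m A) x - dual (u *m A) y.
  by rewrite /dual !mulmxDr !mulmxA !mxE; lia.
by congr intr; have := hij k l; have := hkl i j; rewrite !dualA; lia.
Qed.

End Lattice.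
Arguments lhull R {d n} v.

(** * Vertices and volumes of lattice simplices *)

(** Homogeneous coordinates: row [i] is [(1, v i)], so affine relations between the points are
    linear relations between the rows. *)
Definition homog (K : comNzRingType) d n (v : 'I_n -> 'cV[K]_d) : 'M[K]_(n, d.+1) :=
  \matrix_(i, k) oapp (fun j => v i j 0) 1 (unlift ord0 k).

Lemma homogE0 (K : comNzRingType) d n (v : 'I_n -> 'cV[K]_d) i : homog v i ord0 = 1.
Proof. by rewrite mxE unlift_none. Qed.

Lemma homogES (K : comNzRingType) d n (v : 'I_n -> 'cV[K]_d) i j :
  homog v i (lift ord0 j) = v i j 0.
Proof. by rewrite mxE liftK. Qed.

Section Vertices.
Variable R : realType.

Lemma affinely_independent_homog d n (p : 'I_n -> 'cV[R]_d) :
  affinely_independent p <-> row_free (homog p).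
Proof.
split=> [indep|Mfree c c0 cp].
  apply: inj_row_free => v vM; apply/rowP => j; rewrite mxE.
  apply: (indep (fun k => v 0 k)).
    move/matrixP/(_ 0 ord0): vM; rewrite !mxE => vM0; rewrite -[RHS]vM0.
    by apply: eq_bigr => k _; rewrite homogE0 mulr1.
  apply/colP => k; move/matrixP/(_ 0 (lift ord0 k)): vM; rewrite !mxE summxE => vMk; rewrite -[RHS]vMk.
  by apply: eq_bigr => l _; rewrite homogES mxE.
pose v : 'rV[R]_n := \row_i c i.
suff : v *m homog p = 0 *m homog p.
  by move/(row_free_inj Mfree)/rowP => h i; have := h i; rewrite !mxE.
rewrite mul0mx; apply/rowP => k; rewrite !mxE.
case: (unliftP ord0 k) => [j ->|->].
  move/matrixP/(_ j 0): cp; rewrite summxE mxE => cpj; rewrite -[RHS]cpj.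
  by apply: eq_bigr => i _; rewrite homogES !mxE.
by rewrite -[RHS]c0; apply: eq_bigr => i _; rewrite homogE0 mxE mulr1.
Qed.

(** Column [i] of a right inverse of the homogeneous matrix is an affine functional with value 1 at
    [p i] and 0 at the other points; its linear part separates. *)
Lemma affinely_independent_separated d n (p : 'I_n -> 'cV[R]_d) i :
  affinely_independent p ->
  exists u : 'rV[R]_d, forall j, j != i -> (u *m p j) 0 0 < (u *m p i) 0 0.
Proof.
move/affinely_independent_homog => Mfree.
have := mulmxVp Mfree; move: (pinvmx _) => Q /matrixP MQ.
exists (\row_k Q (lift ord0 k) i) => j ji.
have delta k : Q ord0 i + ((\row_k Q (lift ord0 k) i) *m p k) 0 0 = (k == i)%:R.
  have := MQ k i; rewrite [LHS]mxE [RHS]mxE => <-.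
  rewrite mxE big_ord_recl homogE0 mul1r; congr (_ + _).
  by apply: eq_bigr => l _; rewrite homogES mxE mulrC.
have := delta j; have := delta i; rewrite eqxx (negPf ji) /=; lra.
Qed.

(** The point [p i] is the unique maximum of a functional on the hull, so the hull without it is
    still convex. If [p i] were no [q j], this smaller set would contain all of [q] and therefore
    the whole hull. *)
Lemma convex_hull_vertex d n m (p : 'I_n -> 'cV[R]_d) (q : 'I_m -> 'cV[R]_d) i :
  affinely_independent p -> convex_hull (range p) = convex_hull (range q) ->
  exists j, p i = q j.
Proof.
move=> indep pq; have [u hu] := affinely_independent_separated i indep.
pose S : set 'cV[R]_d := [set x | x = p i \/ (u *m x) 0 0 < (u *m p i) 0 0].
have uconv (x y : 'cV[R]_d) (t : {i01 R}) :
    (u *m (conv t (x : convex_lmodType _) (y : convex_lmodType _) : 'cV[R]_d)) 0 0 =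
    t%:num * (u *m x) 0 0 + (1 - t%:num) * (u *m y) 0 0.
  by rewrite convE mulmxDr -!scalemxAr mxE [X in X + _]mxE [X in _ + X]mxE.
have cS : convex_set (S : set (convex_lmodType _)).
  apply/convex_setW => x y /set_mem hx /set_mem hy t t0 t1; apply/mem_set.
  case: hx hy => [->|hx] [->|hy]; first by left; rewrite convmm.
  - by right; rewrite uconv; nra.
  - by right; rewrite uconv; nra.
  - by right; rewrite uconv; nra.
have pS : convex_hull (range p) `<=` S.
  apply: convex_hull_min => // _ [j _ <-]; rewrite /S /=.
  by have [->|/hu] := eqVneq j i; [left|right].
apply: contrapT => npq.
have cC : convex_set ([set x | convex_hull (range p) x /\ x <> p i] :
    set (convex_lmodType _)).
  apply/convex_setW => x y /set_mem[hx xp] /set_mem[hy yp] t t0 t1; apply/mem_set; split.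
    by apply/set_mem/convex_hull_convex; exact/mem_set.
  have [//|hux] := pS _ hx; have [//|huy] := pS _ hy.
  by move/(congr1 (fun z : 'cV[R]_d => (u *m z) 0 0)); rewrite uconv; nra.
have : convex_hull (range q) (p i) by rewrite -pq; apply: convex_hull_sub; exists i.
move/(convex_hull_min cC); case=> // _ [j _ <-]; split.
  by rewrite pq; apply: convex_hull_sub; exists j.
by move=> qp; apply: npq; exists j.
Qed.

(** The signed volume multiplied by [d!]. *)
Definition vol d (v : 'I_d.+1 -> 'cV[int]_d) : int := \det (homog v).

Lemma affinely_independent_vol d (v : 'I_d.+1 -> 'cV[int]_d) :
  affinely_independent (fun i => intmx R (v i)) <-> vol v != 0.
Proof.
rewrite affinely_independent_homog.
have -> : homog (fun i => intmx R (v i)) = map_mx intr (homog v).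
  by apply/matrixP => i k; rewrite !mxE; case: unliftP => [j|] _ /=; rewrite ?mxE.
by rewrite row_free_unit unitmxE det_map_mx unitfE intr_eq0.
Qed.

Lemma vol_affine d (A : 'M[int]_d) b (v : 'I_d.+1 -> 'cV[int]_d) :
  vol (fun i => A *m v i + b) = \det A * vol v.
Proof.
rewrite /vol mulrC.
(* An affine map acts on homogeneous rows by right multiplication with this block triangular matrix,
   whose determinant is that of [A]. *)
pose B : 'M[int]_(1 + d) := block_mx 1%:M (trmx b) 0 (trmx A).
have eS j : lift ord0 j = rshift 1 j :> 'I_(1 + d) by apply/val_inj.
have e0 : ord0 = lshift d ord0 :> 'I_(1 + d) by apply/val_inj.
have B00 : B ord0 ord0 = 1 by rewrite /B [in LHS]e0 block_mxEul mxE.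
have B0S j : B ord0 (lift ord0 j) = b j 0.
  by rewrite /B eS [X in block_mx _ _ _ _ X]e0 block_mxEur mxE.
have BS0 j : B (lift ord0 j) ord0 = 0.
  by rewrite /B eS [X in block_mx _ _ _ _ _ X]e0 block_mxEdl mxE.
have BSS j k : B (lift ord0 j) (lift ord0 k) = A k j.
  by rewrite /B !eS block_mxEdr mxE.
have -> : homog (fun i => A *m v i + b) = homog v *m B.
  apply/matrixP => i k; rewrite [RHS]mxE big_ord_recl homogE0 mul1r.
  under eq_bigr do rewrite homogES.
  case: (unliftP ord0 k) => [j ->|->].
    rewrite homogES B0S !mxE addrC; congr (_ + _).
    by apply: eq_bigr => l _; rewrite BSS mulrC.
  rewrite homogE0 B00 big1 ?addr0// => l _.
  by rewrite BS0 mulr0.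
by rewrite det_mulmx (det_ublock (1%:M : 'M[int]_1)) det1 mul1r det_tr.
Qed.

Lemma vol_perm d (s : 'S_d.+1) (v : 'I_d.+1 -> 'cV[int]_d) :
  vol (fun i => v (s i)) = (-1) ^+ s * vol v.
Proof.
rewrite /vol -det_perm -det_mulmx -row_permE; congr (\det _).
by apply/matrixP => i k; rewrite !mxE.
Qed.

(** Each image of a vertex of [v] is a vertex of the second hull, hence some [w j]. Two images with
    the same [j] would give equal rows and volume zero, so the assignment is a permutation. *)
Lemma affine_equiv_vertices d (v w : 'I_d.+1 -> 'cV[int]_d) :
  vol v != 0 -> affine_equiv (lhull R v) (lhull R w) ->
  exists (A : 'M[int]_d) (b : 'cV[int]_d) (s : 'S_d.+1),
    A \in unitmx /\ forall i, A *m v i + b = w (s i).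
Proof.
move=> v0 [A [b [uA]]]; rewrite -/(affmap _ _) affmap_lhull => wAv.
exists A, b.
have Av0 : vol (fun i => A *m v i + b) != 0.
  by rewrite vol_affine mulf_neq0 //; apply: contraTneq uA; rewrite unitmxE => ->.
have /choice[f hf] i : exists j, A *m v i + b = w j.
  have /affinely_independent_vol indep := Av0.
  by have [j /intmx_inj] := convex_hull_vertex i indep (esym wAv); exists j.
suff inj_f : injective f by exists (perm inj_f); split => // i; rewrite permE.
move=> i j fij; apply/eqP; apply: contraTT Av0 => ij; rewrite negbK.
apply/eqP/(determinant_alternate ij) => k.
by rewrite !mxE; case: unlift => //= l; rewrite !hf fij.
Qed.

Lemma vol_equiv d (v w : 'I_d.+1 -> 'cV[int]_d) :
  vol v != 0 -> affine_equiv (lhull R v) (lhull R w) ->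
  `|vol v| = `|vol w|.
Proof.
move=> v0 /(affine_equiv_vertices v0)[A [b [s [uA h]]]].
have := vol_perm s w; have <- : (fun i => A *m v i + b) = (fun i => w (s i)) by apply/funext.
rewrite vol_affine => /(congr1 Num.norm); rewrite !normrM normrX normrN1 expr1n mul1r => <-.
by case/orP: uA => /eqP ->; rewrite ?normrN normr1 mul1r.
Qed.

End Vertices.

(** * Reduced pairs of rows *)

(* The width of a triangle with edge vectors p, q ([t = true]), or the larger
   width of two segments with directions p, q ([t = false]), with respect to a
   functional taking the values x, y at p, q. *)
Definition hnorm (t : bool) (x y : int) : int :=
  Num.max (Num.max `|x| `|y|) (if t then `|x - y| else 0).

Lemma hnorm_leP t x y w :
  (hnorm t x y <= w) = [&& `|x| <= w, `|y| <= w & t ==> (`|x - y| <= w)].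
Proof.
rewrite /hnorm !ge_max -andbA; case: t => //=.
by have [h|] := leP `|x| w => //=; rewrite (le_trans (normr_ge0 x) h).
Qed.

Lemma hnorm_ge t x y :
  [/\ `|x| <= hnorm t x y, `|y| <= hnorm t x y & t ==> (`|x - y| <= hnorm t x y)].
Proof. by have := lexx (hnorm t x y); rewrite hnorm_leP => /and3P. Qed.

Lemma hnorm_ge0 t x y : 0 <= hnorm t x y.
Proof. by have [h _ _] := hnorm_ge t x y; exact: le_trans (normr_ge0 x) h. Qed.

Lemma eq_hnorm t x y x' y' :
  (forall w, [&& `|x| <= w, `|y| <= w & t ==> (`|x - y| <= w)] =
             [&& `|x'| <= w, `|y'| <= w & t ==> (`|x' - y'| <= w)]) ->
  hnorm t x y = hnorm t x' y'.
Proof.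
move=> h; apply/eqP; rewrite eq_le; apply/andP; split.
- by rewrite hnorm_leP h -hnorm_leP.
- by rewrite hnorm_leP -h -hnorm_leP.
Qed.

Lemma hnormD t x y x' y' :
  hnorm t (x + x') (y + y') <= hnorm t x y + hnorm t x' y'.
Proof.
have [h1 h2 h3] := hnorm_ge t x y; have [h1' h2' h3'] := hnorm_ge t x' y'.
rewrite hnorm_leP; apply/and3P; split.
- exact: le_trans (ler_normD _ _) (lerD h1 h1').
- exact: le_trans (ler_normD _ _) (lerD h2 h2').
- case: (t) h3 h3' => //= h3 h3'; rewrite opprD addrACA.
  exact: le_trans (ler_normD _ _) (lerD h3 h3').
Qed.

Lemma hnorm_opp t x y : hnorm t (- x) (- y) = hnorm t x y.
Proof. by apply: eq_hnorm => w; rewrite -opprD !normrN. Qed.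

Lemma hnormZ t k x y : hnorm t (k * x) (k * y) = `|k| * hnorm t x y.
Proof.
rewrite /hnorm -mulrBr !normrM !maxr_pMr //.
by case: t; rewrite ?mulr0.
Qed.

(** Lagrange-Gauss reduction for [hnorm]: only the neighbours [c + a] and [c - a] are tested, yet
    for [w2 <= w3] this makes the two norms the successive minima. *)
Definition reduced t a b c d w2 w3 :=
  [/\ hnorm t a b = w2, hnorm t c d = w3,
      w3 <= hnorm t (c + a) (d + b) & w3 <= hnorm t (c - a) (d - b)].

(** Triangle inequality: [m (c + a)] is the given combination plus [(m - n) c] when [n <= m], and
    [n (c + a)] is it plus [(n - m) a] otherwise. Since [c + a] has norm at least [w3], what is left
    is at least [n w3], respectively [m w3]. *)
Lemma hnorm_gauss_pos t a b c d w2 w3 m n :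
  hnorm t a b = w2 -> hnorm t c d = w3 -> 0 < w2 <= w3 ->
  w3 <= hnorm t (c + a) (d + b) -> 0 <= m -> 0 < n ->
  w3 <= hnorm t (m * a + n * c) (m * b + n * d).
Proof.
move=> ha hc hw hs hm hn; set X := hnorm _ _ _ in hs *.
have [-> |m0] := eqVneq m 0.
  by rewrite /X !mul0r !add0r hnormZ hc; nia.
have [nm|mn] := leP n m.
  have := hnormD t (m * a + n * c) (m * b + n * d) ((m - n) * c) ((m - n) * d).
  have -> : m * a + n * c + (m - n) * c = m * (c + a) by ring.
  have -> : m * b + n * d + (m - n) * d = m * (d + b) by ring.
  by rewrite !hnormZ hc -/X; nia.
have := hnormD t (m * a + n * c) (m * b + n * d) ((n - m) * a) ((n - m) * b).
have -> : m * a + n * c + (n - m) * a = n * (c + a) by ring.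
have -> : m * b + n * d + (n - m) * b = n * (d + b) by ring.
rewrite !hnormZ ha -/X; nia.
Qed.

Lemma reduced_ge t a b c d w2 w3 m n :
  reduced t a b c d w2 w3 -> 0 < w2 <= w3 -> n != 0 ->
  w3 <= hnorm t (m * a + n * c) (m * b + n * d).
Proof.
case=> ha hc hp hm hw n0.
wlog n_gt0 : m n n0 / 0 < n => [th|].
  have [n_gt0|n_le0] := ltP 0 n; first exact: th.
  have := th (- m) (- n); rewrite !mulNr -!opprD hnorm_opp; apply; lia.
have [m0|m0] := leP 0 m; first exact: (hnorm_gauss_pos ha hc hw hp).
rewrite -[m * a]mulrNN -[m * b]mulrNN.
by apply: (@hnorm_gauss_pos t (- a) (- b) c d w2); rewrite ?hnorm_opp //; lia.
Qed.

Lemma reduced_gt0 t a b c d w2 w3 m n :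
  reduced t a b c d w2 w3 -> 0 < w2 <= w3 -> (m != 0) || (n != 0) ->
  w2 <= hnorm t (m * a + n * c) (m * b + n * d).
Proof.
move=> red hw; have [-> /=|n0 _] := eqVneq n 0; last first.
  by have := reduced_ge m red hw n0; lia.
rewrite orbF => m0; case: red => ha _ _ _.
by rewrite !mul0r !addr0 hnormZ ha; nia.
Qed.

(* For [t = true] these are the six permutations of the vertices of a triangle,
   acting on the values of a functional relative to the first vertex; for
   [t = false] they are the signed permutations of the two edge directions. *)
Definition rho (t s1 s2 s3 : bool) (v : int * int) : int * int :=
  let: (x, y) := v in
  let: (x', y') :=
    if t then if s2 then (- x, y - x) else if s3 then (x - y, - y) else (x, y)
    else (if s2 then - x else x, if s3 then - y else y) in
  if s1 then (y', x') else (x', y').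

Lemma hnorm_rho t s1 s2 s3 v :
  hnorm t (rho t s1 s2 s3 v).1 (rho t s1 s2 s3 v).2 = hnorm t v.1 v.2.
Proof.
case: v => x y; apply: eq_hnorm => w.
have sub1 : - x - (y - x) = - y by ring.
have sub2 : x - y - - y = x by ring.
have swap a b : `|a - b| = `|b - a| :> int by exact: distrC.
case: t; case: s1; case: s2; case: s3 => /=;
  rewrite ?[`|_ - - x|]swap ?[`|- y - _|]swap ?sub1 ?sub2 ?normrN ?[`|y - x|]swap //;
  by case: (`|x| <= w); case: (`|y| <= w); case: (`|x - y| <= w).
Qed.

Definition lin2 (m n : int) (u v : int * int) : int * int :=
  (m * u.1 + n * v.1, m * u.2 + n * v.2).

Lemma rho_lin2 t s1 s2 s3 m n u v :
  rho t s1 s2 s3 (lin2 m n u v) = lin2 m n (rho t s1 s2 s3 u) (rho t s1 s2 s3 v).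
Proof.
case: u v => x y [x' y']; case: t; case: s1; case: s2; case: s3;
 rewrite /rho /lin2 /=; congr pair; ring.
Qed.

Lemma reduced_rho t s1 s2 s3 u v w2 w3 :
  reduced t u.1 u.2 v.1 v.2 w2 w3 ->
  let u' := rho t s1 s2 s3 u in let v' := rho t s1 s2 s3 v in
  reduced t u'.1 u'.2 v'.1 v'.2 w2 w3.
Proof.
move=> [ha hc hp hm] u' v'; rewrite /reduced !hnorm_rho; split => //.
- have := hnorm_rho t s1 s2 s3 (lin2 1 1 u v); rewrite rho_lin2 -/u' -/v' /lin2 /=.
  by rewrite !mul1r [u'.1 + _]addrC [u'.2 + _]addrC [u.1 + _]addrC [u.2 + _]addrC => ->.
- have := hnorm_rho t s1 s2 s3 (lin2 (-1) 1 u v); rewrite rho_lin2 -/u' -/v' /lin2 /=.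
  by rewrite !mul1r !mulN1r ![- _ + _]addrC => ->.
Qed.

(** Gauss' algorithm: order the rows by norm and add or subtract the shorter one as long as the
    longer one shrinks. The sum of the norms decreases, and the nonzero determinant keeps the
    shorter row away from zero. *)
Lemma reduced_basis_exists t a b c d : a * d != b * c ->
  exists m n k l w2 w3, [/\ `|m * l - n * k| = 1, 0 < w2 <= w3 &
    reduced t (m * a + n * c) (m * b + n * d) (k * a + l * c) (k * b + l * d) w2 w3].
Proof.
have [N] := ubnP (absz (hnorm t a b) + absz (hnorm t c d)).
have pos := hnorm_ge0 t.
elim: N a b c d => // N IH a b c d hN nd.
wlog le12 : a b c d hN nd / hnorm t a b <= hnorm t c d => [th|].
  have [le12|/ltW le21] := leP (hnorm t a b) (hnorm t c d); first exact: th.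
  have hN' : (`|hnorm t c d| + `|hnorm t a b| < N.+1)%N by lia.
  have nd' : c * b != d * a by lia.
  have [m [n [k [l [w2 [w3 [h1 h2 h3]]]]]]] := th c d a b hN' nd' le21.
  exists n, m, l, k, w2, w3; split; [lia|done|].
  by rewrite ![n * _ + _]addrC ![l * _ + _]addrC.
have step e : e = 1 \/ e = -1 -> hnorm t (c + e * a) (d + e * b) < hnorm t c d ->
  exists m n k l w2 w3, [/\ `|m * l - n * k| = 1, 0 < w2 <= w3 &
    reduced t (m * a + n * c) (m * b + n * d) (k * a + l * c) (k * b + l * d) w2 w3].
  move=> he lt; have [| |m [n [k [l [w2 [w3 [h1 h2 h3]]]]]]] := IH a b (c + e * a) (d + e * b).
  - by have := pos (c + e * a) (d + e * b); have := pos a b; lia.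
  - by apply: contraNN nd => /eqP h; apply/eqP; nia.
  exists (m + n * e), n, (k + l * e), l, w2, w3; split => //; first by rewrite -h1; congr `|_|; ring.
  by move: h3; congr reduced; ring.
have [lt1|hp] := ltP (hnorm t (c + a) (d + b)) (hnorm t c d).
  by apply: (step 1); [left|rewrite !mul1r].
have [lt2|hm] := ltP (hnorm t (c - a) (d - b)) (hnorm t c d).
  by apply: (step (-1)); [right|rewrite !mulN1r].
exists 1, 0, 0, 1, (hnorm t a b), (hnorm t c d); split => //.
  have : hnorm t a b != 0.
     apply: contraNneq nd => h0.
    have [ha hb _] := hnorm_ge t a b; rewrite h0 !normr_le0 in ha hb.
    rewrite (eqP ha) (eqP hb).
    by rewrite !mul0r.
  by have := pos a b; lia.
by rewrite !mul1r !mul0r !addr0 !add0r; split.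
Qed.

(** * Tetrahedra in coordinates *)

Local Notation o0 := (@Ordinal 3 0 isT).
Local Notation o1 := (@Ordinal 3 1 isT).
Local Notation o2 := (@Ordinal 3 2 isT).

Lemma ord3P (P : 'I_3 -> Prop) : P o0 -> P o1 -> P o2 -> forall i, P i.
Proof.
move=> p0 p1 p2 [[|[|[|//]]] hi].
- by rewrite (_ : Ordinal hi = o0) //; apply/val_inj.
- by rewrite (_ : Ordinal hi = o1) //; apply/val_inj.
- by rewrite (_ : Ordinal hi = o2) //; apply/val_inj.
Qed.

Lemma sum_ord3 (V : nmodType) (F : 'I_3 -> V) :
  \sum_(i < 3) F i = F o0 + F o1 + F o2.
Proof.
rewrite !big_ord_recr big_ord0 /= add0r.
by congr (F _ + F _ + F _); apply/val_inj.
Qed.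

Definition pt (x y z : int) : 'cV[int]_3 := \col_i [:: x; y; z]`_i.

Definition mx3 (a b c d e f g h i : int) : 'M[int]_3 :=
  \matrix_(k, l) (nth [::] [:: [:: a; b; c]; [:: d; e; f]; [:: g; h; i]] k)`_l.

Lemma ptE (v : 'cV[int]_3) : v = pt (v o0 0) (v o1 0) (v o2 0).
Proof.
by apply/colP; apply: ord3P; rewrite mxE.
Qed.

Lemma pt_inj x y z x' y' z' : pt x y z = pt x' y' z' -> [/\ x = x', y = y' & z = z'].
Proof.
move/colP => h; have := h o0; have := h o1; have := h o2; rewrite !mxE /=.
by split.
Qed.

Lemma ptD x y z x' y' z' : pt x y z + pt x' y' z' = pt (x + x') (y + y') (z + z').
Proof. by apply/colP; apply: ord3P; rewrite !mxE. Qed.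

Lemma mx3E (A : 'M[int]_3) :
  A = mx3 (A o0 o0) (A o0 o1) (A o0 o2) (A o1 o0) (A o1 o1) (A o1 o2)
    (A o2 o0) (A o2 o1) (A o2 o2).
Proof.
by apply/matrixP; apply: ord3P; apply: ord3P; rewrite mxE.
Qed.

Lemma mx3_pt a b c d e f g h i x y z :
  mx3 a b c d e f g h i *m pt x y z =
  pt (a * x + b * y + c * z) (d * x + e * y + f * z) (g * x + h * y + i * z).
Proof. by apply/colP; apply: ord3P; rewrite !mxE sum_ord3 !mxE. Qed.

Lemma det_mx3 (K : comNzRingType) (A : 'M[K]_3) : \det A =
  A o0 o0 * (A o1 o1 * A o2 o2 - A o1 o2 * A o2 o1)
  - A o0 o1 * (A o1 o0 * A o2 o2 - A o1 o2 * A o2 o0)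
  + A o0 o2 * (A o1 o0 * A o2 o1 - A o1 o1 * A o2 o0).
Proof.
(* Indexing by natural numbers lets simplification identify the lifted ordinals produced by the
   expansion. *)
pose f (i j : nat) := A (inord i) (inord j).
have E i j : A i j = f i j by rewrite /f !inord_val.
rewrite (expand_det_row _ o0) sum_ord3 /cofactor.
rewrite !(expand_det_row _ (@Ordinal 2 0 isT)) !big_ord_recl !big_ord0 /cofactor !det_mx11 !mxE.
rewrite !E /=; ring.
Qed.

Lemma dual_pt (u : 'rV[int]_3) x y z :
  dual u (pt x y z) = u 0 o0 * x + u 0 o1 * y + u 0 o2 * z.
Proof. by rewrite /dual mxE sum_ord3 !mxE. Qed.

Definition vs (p0 p1 p2 p3 : 'cV[int]_3) : 'I_4 -> 'cV[int]_3 :=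
  fun i => nth 0 [:: p0; p1; p2; p3] i.

Section Tetrahedra.
Variable R : realType.

Lemma lhull_vs p0 p1 p2 p3 : lhull R (vs p0 p1 p2 p3) =
  convex_hull [set intmx R p0; intmx R p1; intmx R p2; intmx R p3].
Proof.
congr convex_hull; apply/seteqP; split.
  by move=> _ [[[|[|[|[|//]]]] hi] _ <-] /=; tauto.
move=> x /= [[[->|->]|->]|->].
- by exists (@Ordinal 4 0 isT).
- by exists (@Ordinal 4 1 isT).
- by exists (@Ordinal 4 2 isT).
- by exists (@Ordinal 4 3 isT).
Qed.

Lemma affine_equiv_vs A b p0 p1 p2 p3 q0 q1 q2 q3 : A \in unitmx ->
  A *m p0 + b = q0 -> A *m p1 + b = q1 -> A *m p2 + b = q2 -> A *m p3 + b = q3 ->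
  affine_equiv (lhull R (vs p0 p1 p2 p3)) (lhull R (vs q0 q1 q2 q3)).
Proof.
move=> uA <- <- <- <-; have := affine_equiv_lhull R b (vs p0 p1 p2 p3) uA.
congr (affine_equiv _ (lhull R _)); apply/funext => i.
by case: i => [[|[|[|[|//]]]] hi].
Qed.

End Tetrahedra.

Lemma unitmx_mx3 a b c d e f g h i :
  a * (e * i - f * h) - b * (d * i - f * g) + c * (d * h - e * g) \in [:: 1; -1] ->
  mx3 a b c d e f g h i \in unitmx.
Proof.
by rewrite !inE unitmxE det_mx3 !mxE.
Qed.

Lemma vol_vs0 x y z x' y' z' x'' y'' z'' :
  vol (vs (pt 0 0 0) (pt x y z) (pt x' y' z') (pt x'' y'' z'')) =
  x * (y' * z'' - z' * y'') - y * (x' * z'' - z' * x'') + z * (x' * y'' - y' * x'').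
Proof.
rewrite /vol (expand_det_row _ ord0) big_ord_recl homogE0 mul1r.
rewrite big1 => [|i _]; last first.
  by rewrite homogES; move: i; apply: ord3P; rewrite mxE mul0r.
rewrite addr0 /cofactor expr0 mul1r det_mx3 !mxE /=.
have liftE i : lift (@ord0 3) i = lift ord0 i by [].
rewrite !liftK /= !mxE /=; ring.
Qed.

(* [u] and [v] are the rows of the matrix whose columns are the difference
   vectors: [t = true] puts a triangle at height 0, [t = false] one edge at each
   height. *)
Definition tet (t : bool) (u v : int * int) : 'I_4 -> 'cV[int]_3 :=
  if t then vs (pt 0 0 0) (pt 0 u.1 v.1) (pt 0 u.2 v.2) (pt 1 0 0)
  else vs (pt 0 0 0) (pt 0 u.1 v.1) (pt 1 0 0) (pt 1 u.2 v.2).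

Definition cross (u v : int * int) : int := u.1 * v.2 - u.2 * v.1.

Lemma vol_tet t u v : `|vol (tet t u v)| = `|cross u v|.
Proof. by rewrite /tet /cross; case: t; rewrite vol_vs0; lia. Qed.

(** * Explicit equivalences between the tetrahedra [tet] *)

Section Equivalence.
Variable R : realType.
Local Notation "P ~~ Q" := (@affine_equiv R 3 P Q) (at level 70).
Local Notation T t u v := (lhull R (tet t u v)).

Lemma lhull_swap01 p0 p1 p2 p3 : lhull R (vs p0 p1 p2 p3) = lhull R (vs p1 p0 p2 p3).
Proof. by rewrite !lhull_vs; congr convex_hull; apply/seteqP; split=> x /=; tauto. Qed.

Lemma lhull_swap12 p0 p1 p2 p3 : lhull R (vs p0 p1 p2 p3) = lhull R (vs p0 p2 p1 p3).
Proof. by rewrite !lhull_vs; congr convex_hull; apply/seteqP; split=> x /=; tauto. Qed.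

Lemma lhull_swap23 p0 p1 p2 p3 : lhull R (vs p0 p1 p2 p3) = lhull R (vs p0 p1 p3 p2).
Proof. by rewrite !lhull_vs; congr convex_hull; apply/seteqP; split=> x /=; tauto. Qed.

Lemma affine_equiv_pts a b c d e f g h i x y z p0 p1 p2 p3 q0 q1 q2 q3 :
  a * (e * i - f * h) - b * (d * i - f * g) + c * (d * h - e * g) \in [:: 1; -1] ->
  let F p := mx3 a b c d e f g h i *m p + pt x y z in
  F p0 = q0 -> F p1 = q1 -> F p2 = q2 -> F p3 = q3 ->
  lhull R (vs p0 p1 p2 p3) ~~ lhull R (vs q0 q1 q2 q3).
Proof. by move=> /unitmx_mx3 uA F; apply: affine_equiv_vs. Qed.

(** The map normalises the height, moves the first vertex to the origin and shears along the height
    so that the apex lands on [(1, 0, 0)]; the position of the apex is therefore immaterial. In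
    [lift2_2] the same shear places the third vertex. *)
Lemma lift3_1 g e x0 y0 x1 y1 x2 y2 x3 y3 : e \in [:: 1; -1] ->
  lhull R (vs (pt g x0 y0) (pt g x1 y1) (pt g x2 y2) (pt (g + e) x3 y3)) ~~
  T true (x1 - x0, x2 - x0) (y1 - y0, y2 - y0).
Proof.
rewrite !inE => he.
apply: (@affine_equiv_pts e 0 0 (e * (x0 - x3)) 1 0 (e * (y0 - y3)) 0 1
  (- e * g) (- x0 - e * (x0 - x3) * g) (- y0 - e * (y0 - y3) * g)) => /=.
- by case/orP: he => /eqP->; rewrite !inE; apply/orP; [left|right]; apply/eqP; ring.
all: by rewrite mx3_pt ptD; case/orP: he => /eqP->; congr pt; ring.
Qed.

Lemma lift2_2 g e x0 y0 x1 y1 x2 y2 x3 y3 : e \in [:: 1; -1] ->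
  lhull R (vs (pt g x0 y0) (pt g x1 y1) (pt (g + e) x2 y2) (pt (g + e) x3 y3)) ~~
  T false (x1 - x0, x3 - x2) (y1 - y0, y3 - y2).
Proof.
rewrite !inE => he.
apply: (@affine_equiv_pts e 0 0 (e * (x0 - x2)) 1 0 (e * (y0 - y2)) 0 1
  (- e * g) (- x0 - e * (x0 - x2) * g) (- y0 - e * (y0 - y2) * g)) => /=.
- by case/orP: he => /eqP->; rewrite !inE; apply/orP; [left|right]; apply/eqP; ring.
all: by rewrite mx3_pt ptD; case/orP: he => /eqP->; congr pt; ring.
Qed.

(** Row operations come from GL_2(Z) acting on the last two coordinates. *)
Lemma tet_lin2 t m n k l u v : m * l - n * k \in [:: 1; -1] ->
  T t u v ~~ T t (lin2 m n u v) (lin2 k l u v).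
Proof.
move=> hd; rewrite /tet; case: t.
all: apply: (@affine_equiv_pts 1 0 0 0 m n 0 k l 0 0 0) => /=;
  [by rewrite (_ : _ + _ = m * l - n * k) //; ring| | | |];
  by rewrite mx3_pt ptD; congr pt; ring.
Qed.

(** For a triangle this only renames two vertices; for two edges the planes are exchanged by the
    reflection that replaces the height by one minus it. *)
Lemma tet_swap t u v : T t u v ~~ T t (u.2, u.1) (v.2, v.1).
Proof.
case: t => /=; rewrite /tet /=; first by rewrite lhull_swap12; exact: affine_equiv_refl.
rewrite lhull_swap12 lhull_swap01 lhull_swap23 lhull_swap12.
apply: (@affine_equiv_pts (-1) 0 0 0 1 0 0 0 1 1 0 0) => //=.
all: by rewrite mx3_pt ptD; congr pt; ring.
Qed.

(** The first two vertices exchange roles. Moving the new first vertex to the origin is a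
    translation, and a shear undoes it at height one. *)
Lemma tet_flip t u v : T t u v ~~
  if t then T t (- u.1, u.2 - u.1) (- v.1, v.2 - v.1) else T t (- u.1, u.2) (- v.1, v.2).
Proof.
case: t; rewrite /tet /= lhull_swap01.
all: apply: (@affine_equiv_pts 1 0 0 u.1 1 0 v.1 0 1 0 (- u.1) (- v.1)) => /=;
  first by rewrite (_ : _ + _ = 1) //; ring.
all: by rewrite mx3_pt ptD; congr pt; ring.
Qed.

Lemma tet_rho t s1 s2 s3 u v : T t u v ~~ T t (rho t s1 s2 s3 u) (rho t s1 s2 s3 v).
Proof.
have refl (P : set _) : P ~~ P := affine_equiv_refl P.
have swap w z : T t w z ~~ T t (if s1 then (w.2, w.1) else w) (if s1 then (z.2, z.1) else z).
  by case: s1; [exact: tet_swap|exact: refl].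
have sw b x1 y1 x2 y2 : T b (x1, y1) (x2, y2) ~~ T b (y1, x1) (y2, x2) := tet_swap b (x1, y1) (x2, y2).
have comp P Q S : P ~~ Q -> Q ~~ S -> P ~~ S := @affine_equiv_trans R 3 P Q S.
case: t swap u v => swap [x y] [x' y'].
  have flip x1 y1 x2 y2 : T true (x1, y1) (x2, y2) ~~ T true (- x1, y1 - x1) (- x2, y2 - x2).
    exact: (tet_flip true (x1, y1) (x2, y2)).
  have flip' x1 y1 x2 y2 : T true (x1, y1) (x2, y2) ~~ T true (x1 - y1, - y1) (x2 - y2, - y2).
    exact: comp _ _ _ (sw _ _ _ _ _) (comp _ _ _ (flip _ _ _ _) (sw _ _ _ _ _)).
  case: s2 => /=; first exact: comp _ _ _ (flip _ _ _ _) (swap (- x, y - x) (- x', y' - x')).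
  case: s3 => /=; last exact: (swap (x, y) (x', y')).
  exact: comp _ _ _ (flip' _ _ _ _) (swap (x - y, - y) (x' - y', - y')).
have flip1 x1 y1 x2 y2 : T false (x1, y1) (x2, y2) ~~
    T false (if s2 then - x1 else x1, y1) (if s2 then - x2 else x2, y2).
  by case: s2; [exact: (tet_flip false (x1, y1) (x2, y2))|exact: refl].
have flip2 x1 y1 x2 y2 : T false (x1, y1) (x2, y2) ~~
    T false (x1, if s3 then - y1 else y1) (x2, if s3 then - y2 else y2).
  case: s3; last exact: refl.
  exact: comp _ _ _ (sw _ _ _ _ _) (comp _ _ _ (tet_flip false (y1, x1) (y2, x2)) (sw _ _ _ _ _)).
have := comp _ _ _ (flip1 x y x' y') (comp _ _ _ (flip2 _ _ _ _) (swap
  (if s2 then - x else x, if s3 then - y else y)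
  (if s2 then - x' else x', if s3 then - y' else y'))).
by rewrite /rho.
Qed.

Definition congr_tet t u v u' v' := exists m n k l s1 s2 s3,
  [/\ m * l - n * k \in [:: 1; -1], u' = rho t s1 s2 s3 (lin2 m n u v) &
      v' = rho t s1 s2 s3 (lin2 k l u v)].

Lemma congr_tet_equiv t u v u' v' : congr_tet t u v u' v' -> T t u v ~~ T t u' v'.
Proof.
move=> [m [n [k [l [s1 [s2 [s3 [hd -> ->]]]]]]]].
exact: affine_equiv_trans (tet_lin2 t u v hd) (tet_rho _ _ _ _ _ _).
Qed.

End Equivalence.

(** * Multi-width *)

Section MultiWidth.
Variable R : realType.
Local Notation "P ~~ Q" := (@affine_equiv R 3 P Q) (at level 70).
Local Notation T t u v := (lhull R (tet t u v)).

Lemma lattice_simplexP d (P : set 'cV[R]_d) :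
  lattice_simplex d P <-> exists2 v : 'I_d.+1 -> 'cV[int]_d, vol v != 0 & P = lhull R v.
Proof.
split=> [[v [/affinely_independent_vol v0 ->]]|[v v0 ->]]; first by exists v.
by exists v; split => //; apply/affinely_independent_vol.
Qed.

Lemma lattice_simplex_equiv d (P Q : set 'cV[R]_d) :
  affine_equiv P Q -> lattice_simplex d P -> lattice_simplex d Q.
Proof.
move=> [A [b [uA ->]]] /lattice_simplexP[v v0 ->]; apply/lattice_simplexP.
exists (fun i => A *m v i + b); last exact: affmap_lhull.
rewrite vol_affine mulf_neq0 //; apply: contraTneq uA.
by rewrite unitmxE => ->.
Qed.

Lemma row_free_intmx d (U : 'M[int]_d) : row_free (intmx R U) = (\det U != 0).
Proof. by rewrite row_free_unit unitmxE det_map_mx unitfE intr_eq0. Qed.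

Lemma is_mwidth_equiv d (P Q : set 'cV[R]_d) w :
  affine_equiv P Q -> lattice_simplex d P -> is_mwidth P w -> is_mwidth Q w.
Proof.
move=> [A [b [uA ->]]] /lattice_simplexP[v v0 ->] [[U freeU ->] minU].
have dA : \det A != 0 by apply: contraTneq uA; rewrite unitmxE => ->.
have widthsA V : widths V [set intmx R A *m x + intmx R b | x in lhull R v] =
    widths (V *m A) (lhull R v).
  apply: eq_from_tnth => i; rewrite !tnth_mktuple.
  by rewrite -/(affmap _ _) affmap_lhull width_affine row_mul.
split.
  exists (U *m invmx A); last by rewrite widthsA -mulmxA mulVmx // mulmx1.
  move: freeU; rewrite !row_free_intmx det_mulmx mulf_eq0 negb_or => -> /=.
  by apply: contraTneq (uA); rewrite -unitmx_inv unitmxE => ->.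
move=> V; rewrite row_free_intmx => V0; rewrite widthsA; apply: minU.
by rewrite row_free_intmx det_mulmx mulf_neq0.
Qed.

Lemma is_mwidth_unique d (P : set 'cV[R]_d) w w' :
  is_mwidth P w -> is_mwidth P w' -> w = w'.
Proof.
move=> [[U freeU eU] minU] [[V freeV eV] minV].
have h1 := minU _ freeV; have h2 := minV _ freeU.
rewrite -eV in h1; rewrite -eU in h2.
by apply: (@Order.POrderTheory.le_anti _ (d.-tuplelexi R)); apply/andP.
Qed.

Lemma lexi_tuple3 (a b c a' b' c' : R) :
  (([tuple a; b; c] : 3.-tuplelexi R) <= ([tuple a'; b'; c'] : 3.-tuplelexi R))%O =
  (a <= a') && ((a' <= a) ==> (b <= b') && ((b' <= b) ==> (c <= c'))).
Proof. by rewrite [LHS]lexi_cons lexi_cons lexi_cons lexis0 /= implybT andbT. Qed.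

Lemma widths3 (U : 'M[int]_3) (P : set 'cV[R]_3) :
  widths U P = [tuple width (row o0 U) P; width (row o1 U) P; width (row o2 U) P].
Proof.
by apply: eq_from_tnth; apply: ord3P; rewrite tnth_mktuple.
Qed.

Lemma width_le d n (u : 'rV[int]_d) (v : 'I_n.+1 -> 'cV[int]_d) (m w : int) :
  (forall i, m <= dual u (v i) <= m + w) -> width u (lhull R v) <= w%:~R.
Proof.
move=> h; have [k [l [_ ->]]] := lhull_width R u v; rewrite ler_int.
by have := h k; have := h l; lia.
Qed.

Lemma lattice_tet t u v : cross u v != 0 -> lattice_tetrahedron (T t u v).
Proof.
by move=> uv; apply/lattice_simplexP; exists (tet t u v) => //; rewrite -normr_gt0 vol_tet normr_gt0.
Qed.

(** Vertices of equal height give differences that do not see the first coefficient, which yields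
    the bound by [hnorm]; the last clause is for functionals of the height alone. *)
Lemma width_tet t u v (r : 'rV[int]_3) :
  let s := lin2 (r 0 o1) (r 0 o2) u v in
  exists w : int, [/\ width r (T t u v) = w%:~R, hnorm t s.1 s.2 <= w &
    r 0 o1 = 0 -> r 0 o2 = 0 -> `|r 0 o0| <= w].
Proof.
move=> s; have [i [j [h ->]]] := lhull_width R r (tet t u v).
exists (dual r (tet t u v i) - dual r (tet t u v j)); move: (_ - _) h => w h.
have H (a b : nat) (ha : (a < 4)%N) (hb : (b < 4)%N) :=
  h (Ordinal ha) (Ordinal hb).
have h01 := H 0%N 1%N isT isT; have h10 := H 1%N 0%N isT isT.
have h02 := H 0%N 2%N isT isT; have h20 := H 2%N 0%N isT isT.
have h12 := H 1%N 2%N isT isT; have h21 := H 2%N 1%N isT isT.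
have h03 := H 0%N 3%N isT isT; have h30 := H 3%N 0%N isT isT.
have h23 := H 2%N 3%N isT isT; have h32 := H 3%N 2%N isT isT.
move: h01 h10 h02 h20 h12 h21 h03 h30 h23 h32; rewrite /s /tet /lin2.
by case: t {h H s} => /=; rewrite /vs /= !dual_pt /hnorm; split => //; lia.
Qed.

(** [lower] bounds every independent triple of functionals lexicographically from below. For the
    explicit matrix [U] it then suffices to bound the three widths from above. *)
Lemma reduced_mwidth t u v (w2 w3 : int) : 0 < w2 <= w3 ->
  reduced t u.1 u.2 v.1 v.2 w2 w3 ->
  is_mwidth (T t u v) [tuple 1; w2%:~R; w3%:~R].
Proof.
move=> hw red.
have lower (U : 'M[int]_3) : \det U != 0 -> exists f0 f1 f2 : int,
    widths U (T t u v) = [tuple f0%:~R; f1%:~R; f2%:~R] /\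
    (([tuple 1; w2%:~R; w3%:~R] : 3.-tuplelexi R) <= 
      ([tuple f0%:~R; f1%:~R; f2%:~R] : 3.-tuplelexi R))%O.
  rewrite det_mx3 => dU; rewrite widths3.
  have bound i : exists f : int, [/\ width (row i U) (T t u v) = f%:~R,
      (U i o1 != 0) || (U i o2 != 0) -> w2 <= f, U i o2 != 0 -> w3 <= f &
      (U i o0 != 0) || (U i o1 != 0) || (U i o2 != 0) -> 1 <= f].
    have [f [-> hf h0]] := width_tet t u v (row i U); exists f.
    rewrite !mxE in hf h0.
    have hf2 : (U i o1 != 0) || (U i o2 != 0) -> w2 <= f.
      by move=> /(reduced_gt0 red hw) h; apply: le_trans hf.
    split => //; first by move=> /(reduced_ge (U i o1) red hw) h; apply: le_trans hf.
    move=> h; have [/hf2|] := boolP ((U i o1 != 0) || (U i o2 != 0)); first lia.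
    rewrite negb_or !negbK => /andP[/eqP h1 /eqP h2]; have := h0 h1 h2.
    by move: h; rewrite h1 h2; lia.
  have [f0 [-> a0 b0 c0]] := bound o0; have [f1 [-> a1 b1 c1]] := bound o1.
  have [f2 [-> a2 b2 c2]] := bound o2; exists f0, f1, f2; split => //.
  rewrite lexi_tuple3 -[1]/(1%:~R) !ler_int.
  (* Rank conditions, each forced by the determinant: the first row and either other row are not
     both multiples of the height, the last column is not zero, and no row is zero. *)
  have d01 : [|| U o0 o1 != 0, U o0 o2 != 0, U o1 o1 != 0 | U o1 o2 != 0].
    by apply: contraNT dU; rewrite !negb_or !negbK => /and4P[/eqP-> /eqP-> /eqP-> /eqP->]; apply/eqP; ring.
  have d02 : [|| U o0 o1 != 0, U o0 o2 != 0, U o2 o1 != 0 | U o2 o2 != 0].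
    by apply: contraNT dU; rewrite !negb_or !negbK => /and4P[/eqP-> /eqP-> /eqP-> /eqP->]; apply/eqP; ring.
  have d012 : [|| U o0 o2 != 0, U o1 o2 != 0 | U o2 o2 != 0].
    by apply: contraNT dU; rewrite !negb_or !negbK => /and3P[/eqP-> /eqP-> /eqP->]; apply/eqP; ring.
  have e0 : (U o0 o0 != 0) || (U o0 o1 != 0) || (U o0 o2 != 0).
    by apply: contraNT dU; rewrite !negb_or !negbK => /andP[/andP[/eqP-> /eqP->] /eqP->]; apply/eqP; ring.
  have e1 : (U o1 o0 != 0) || (U o1 o1 != 0) || (U o1 o2 != 0).
    by apply: contraNT dU; rewrite !negb_or !negbK => /andP[/andP[/eqP-> /eqP->] /eqP->]; apply/eqP; ring.
  have e2 : (U o2 o0 != 0) || (U o2 o1 != 0) || (U o2 o2 != 0).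
    by apply: contraNT dU; rewrite !negb_or !negbK => /andP[/andP[/eqP-> /eqP->] /eqP->]; apply/eqP; ring.
  have {}c0 := c0 e0; have {}c1 := c1 e1; have {}c2 := c2 e2.
  move: d01 d02 d012 {dU bound e0 e1 e2} a0 b0 a1 b1 a2 b2.
  move: (U o0 o1 != 0) (U o0 o2 != 0) (U o1 o1 != 0) (U o1 o2 != 0) (U o2 o1 != 0) (U o2 o2 != 0).
  by do 6![case] => //= _ _ _ a0 b0 a1 b1 a2 b2;
    do ?[have {}a0 := a0 isT]; do ?[have {}b0 := b0 isT];
    do ?[have {}a1 := a1 isT]; do ?[have {}b1 := b1 isT];
    do ?[have {}a2 := a2 isT]; do ?[have {}b2 := b2 isT]; lia.
split=> [|U]; last first.
  by rewrite row_free_intmx => /lower[f0 [f1 [f2 [-> h]]]].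
(* For two edges the shear aligns the lower ends of the intervals of values at the two heights, so
   that the longer interval covers the other. For a triangle the apex already has the value 0 of the
   first vertex. *)
pose c (s : int * int) := if t then 0 else Num.min 0 s.1 - Num.min 0 s.2.
pose U := mx3 1 0 0 (c u) 1 0 (c v) 0 1.
have dU : \det U != 0 by rewrite det_mx3 !mxE /=; apply/eqP; lia.
exists U; first by rewrite row_free_intmx.
have [f0 [f1 [f2 [eU]]]] := lower U dU; rewrite eU lexi_tuple3 -[1]/(1%:~R) !ler_int.
move: eU; rewrite widths3 => /(congr1 val)[e0 e1 e2].
suff : [/\ f0 <= 1, f1 <= w2 & f2 <= w3].
  case=> l0 l1 l2 /andP[g0]; rewrite l0 /= => /andP[g1]; rewrite l1 /= => g2.
  by congr [tuple _; _; _]; congr intr; apply/eqP; rewrite eq_le; apply/andP.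
have [hu hv _ _] := red.
split.
- rewrite -(ler_int R) -e0; apply: (@width_le _ _ _ _ 0) => i.
  case: i => [[|[|[|[|//]]]] hi]; rewrite /tet; case: (t); rewrite /vs /= dual_pt !mxE /=; lia.
- rewrite -(ler_int R) -e1.
  apply: (@width_le _ _ _ _ (if t then Num.min (Num.min 0 u.1) u.2 else Num.min 0 u.1)) => i.
  move: hu; rewrite /hnorm /U /c.
  case: i => [[|[|[|[|//]]]] hi]; rewrite /tet; case: (t); rewrite /vs /= dual_pt !mxE /=; lia.
- rewrite -(ler_int R) -e2.
  apply: (@width_le _ _ _ _ (if t then Num.min (Num.min 0 v.1) v.2 else Num.min 0 v.1)) => i.
  move: hv; rewrite /hnorm /U /c.
  case: i => [[|[|[|[|//]]]] hi]; rewrite /tet; case: (t); rewrite /vs /= dual_pt !mxE /=; lia.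
Qed.

End MultiWidth.

(** * Every tetrahedron with multi-width [(1, w2, w3)] comes from a reduced pair *)

Section Completeness.
Variable R : realType.
Local Notation "P ~~ Q" := (@affine_equiv R 3 P Q) (at level 70).
Local Notation T t u v := (lhull R (tet t u v)).

Lemma vsE (v : 'I_4 -> 'cV[int]_3) :
  v = vs (v (@Ordinal 4 0 isT)) (v (@Ordinal 4 1 isT)) (v (@Ordinal 4 2 isT)) (v (@Ordinal 4 3 isT)).
Proof.
by apply/funext => -[[|[|[|[|//]]]] hi]; rewrite /vs /=; congr v; apply/val_inj.
Qed.

(** Seven distributions of heights are possible: four put three vertices on one plane and three put
    two on each. Renaming the vertices brings each to one of the two standard positions. *)
Lemma equiv_tet_heights (p0 p1 p2 p3 : 'cV[int]_3) (e : int) :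
  e \in [:: 1; -1] ->
  let h p := (p : 'cV[int]_3) o0 0 - p0 o0 0 in
  h p1 \in [:: 0; e] -> h p2 \in [:: 0; e] -> h p3 \in [:: 0; e] ->
  [|| h p1 != 0, h p2 != 0 | h p3 != 0] ->
  exists t u v, lhull R (vs p0 p1 p2 p3) ~~ T t u v.
Proof.
move=> he /=; rewrite (ptE p0) (ptE p1) (ptE p2) (ptE p3) !mxE /=.
move: (p0 o0 0) (p0 o1 0) (p0 o2 0) (p1 o0 0) (p1 o1 0) (p1 o2 0)
  (p2 o0 0) (p2 o1 0) (p2 o2 0) (p3 o0 0) (p3 o1 0) (p3 o2 0).
move=> h0 x0 y0 h1 x1 y1 h2 x2 y2 h3 x3 y3.
have he' : - e \in [:: 1; -1] by move: he; rewrite !inE; lia.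
have eE x y : x - y = e -> x = y + e by move=> <-; ring.
rewrite !inE !subr_eq0 => /orP[/eqP->|/eqP/eE->] /orP[/eqP->|/eqP/eE->] /orP[/eqP->|/eqP/eE->];
  rewrite ?eqxx //= => _.
- by exists true; eexists; eexists; exact: lift3_1.
- rewrite lhull_swap23.
  by exists true; eexists; eexists; exact: lift3_1.
- by exists false; eexists; eexists; exact: lift2_2.
- rewrite lhull_swap12 lhull_swap23.
  by exists true; eexists; eexists; exact: lift3_1.
- rewrite lhull_swap12.
  by exists false; eexists; eexists; exact: lift2_2.
- rewrite lhull_swap23 lhull_swap12.
  by exists false; eexists; eexists; exact: lift2_2.
- rewrite lhull_swap01 lhull_swap12 lhull_swap23.
  (* Here the first vertex is the lone one: the triangle lies at height [h0 + e] and the sign of the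
     step is reversed. *)
  rewrite [X in pt X x0 y0](_ : h0 = h0 + e + (- e)); last by ring.
  by exists true; eexists; eexists; exact: lift3_1.
Qed.

Lemma width1_equiv_tet (P : set 'cV[R]_3) (r : 'rV[int]_3) :
  lattice_tetrahedron P -> width r P = 1 -> exists t u v, P ~~ T t u v.
Proof.
move=> /lattice_simplexP[v v0 ->].
have [i [j [h ->]]] := lhull_width R r v => /eqP.
rewrite -[1]/(1%:~R) eqr_int => /eqP width1; rewrite width1 in h.
(* The Smith normal form of a row vector writes [r] as an integer multiple [e] of the first row of
   the unimodular [M]. After [M] the first coordinates of any two vertices differ by at most one,
   and not all of them agree. *)
have [L uL [M uM [d _ rE]]] := int_Smith_normal_form r.
pose e := L 0 0 * d`_0.
have dualM x : dual r x = e * (M *m x) o0 0.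
  rewrite /dual rE -!mulmxA [LHS]mxE big_ord1 /e -mulrA; congr (_ * _).
  rewrite mxE sum_ord3 !mxE /= mulr1n !mulr0n !mul0r !addr0; congr (_ * _).
have uM0 := affine_equiv_lhull R 0 v uM.
have H (a b : 'I_4) : `|e * (M *m v a) o0 0 - e * (M *m v b) o0 0| <= 1.
  by have := h a b; have := h b a; rewrite !dualM; lia.
have W : e * (M *m v i) o0 0 - e * (M *m v j) o0 0 = 1 by rewrite -!dualM.
have H' (a b : 'I_4) : `|(M *m v a) o0 0 - (M *m v b) o0 0| <= 1.
  have := H a b; have e0 : e != 0 by apply: contra_eq_neq W => ->; rewrite !mul0r.
  rewrite -mulrBr normrM; nia.
have W' : (M *m v i) o0 0 != (M *m v j) o0 0.
  by apply: contra_eq_neq W => ->; rewrite subrr.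
pose w k := M *m v k + 0.
have [t [u1 [u2 hT]]] : exists t u1 u2, lhull R w ~~ T t u1 u2.
  have wE k : w k o0 0 = (M *m v k) o0 0 by rewrite /w addr0.
  have {}H' (a b : 'I_4) : `|w a o0 0 - w b o0 0| <= 1 by rewrite !wE.
  have {}W' : exists k, w k o0 0 != w ord0 o0 0.
    have [wi|wi] := eqVneq (w i o0 0) (w ord0 o0 0); last by exists i.
    by exists j; rewrite -wi !wE eq_sym.
  have [k wk] := W'.
  pose s := w k o0 0 - w ord0 o0 0.
  have s1 : s \in [:: 1; -1] by have := H' k ord0; rewrite !inE /s; lia.
  have hs l : w l o0 0 - w ord0 o0 0 \in [:: 0; s].
    by have := H' l ord0; have := H' l k; have := H' k ord0; rewrite !inE /s; lia.
  have o40 : @Ordinal 4 0 isT = ord0 by apply/val_inj.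
  rewrite [w]vsE; apply: (equiv_tet_heights s1); rewrite /= ?o40; try exact: hs.
  rewrite !subr_eq0; clear s1 hs s; apply: contraTT wk; rewrite !negb_or !negbK => /and3P[h1 h2 h3].
  case: k => -[|[|[|[|//]]]] hk.
  - by apply/eqP; congr (w _ _ _); apply/val_inj.
  - by rewrite -(eqP h1); apply/eqP; congr (w _ _ _); apply/val_inj.
  - by rewrite -(eqP h2); apply/eqP; congr (w _ _ _); apply/val_inj.
  - by rewrite -(eqP h3); apply/eqP; congr (w _ _ _); apply/val_inj.
by exists t, u1, u2; apply: affine_equiv_trans hT.
Qed.

(** The norms found by the reduction are the multi-width of an equivalent tetrahedron, so uniqueness
    of the multi-width identifies them with [w2] and [w3]. *)
Lemma mwidth1_equiv_reduced (P : set 'cV[R]_3) (w2 w3 : int) :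
  lattice_tetrahedron P -> is_mwidth P [tuple 1; w2%:~R; w3%:~R] ->
  exists t u v, P ~~ T t u v /\ reduced t u.1 u.2 v.1 v.2 w2 w3.
Proof.
move=> latP mwP; have [[U _ /(congr1 val) eU] _] := mwP.
have := eU; rewrite widths3 => -[/esym w1 _ _].
have [t [u [v Puv]]] := width1_equiv_tet latP w1.
have uv0 : cross u v != 0.
  have /lattice_simplexP[z z0 zE] := lattice_simplex_equiv Puv latP.
  have zT : lhull R z ~~ T t u v by rewrite -zE; exact: affine_equiv_refl.
  by rewrite -normr_gt0 -(vol_tet t) -(vol_equiv z0 zT) normr_gt0.
have [|m [n [k [l [m2 [m3 [hd hm red]]]]]]] := @reduced_basis_exists t u.1 u.2 v.1 v.2.
  by move: uv0; rewrite /cross subr_eq0.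
have hd' : m * l - n * k \in [:: 1; -1] by rewrite !inE; lia.
have Puv' := affine_equiv_trans Puv (tet_lin2 R t u v hd').
exists t, (lin2 m n u v), (lin2 k l u v); split => //.
have := @reduced_mwidth R t (lin2 m n u v) (lin2 k l u v) m2 m3 hm red.
move=> /(is_mwidth_unique (is_mwidth_equiv Puv' latP mwP)) /(congr1 val)[/intr_inj -> /intr_inj ->].
exact: red.
Qed.

End Completeness.

(** * Normal forms *)

(* The families of the classification, for w2 > 1: [k = 0] is (1)(i) when
   [x = 0] and (1)(ii) when [x > 0], [k = 1] is (1)(iii), and [k = 2, 3, 4] are
   (2), (3), (4). The first row of the matrix of the normal form is [(w2, x)],
   the second is [nf_snd]. *)
Definition nf_triangular (k : nat) : bool := (k < 2)%N.

Definition nf_snd (w2 w3 : int) (k : nat) (x y : int) : int * int :=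
  match k with
  | 0 => (y, w3)
  | 1 => (- y, w3 - y)
  | 2 => (y, w3)
  | 3 => (y, - w3)
  | _ => (w3, y - w3)
  end.

Definition nf_valid (w2 w3 : int) (k : nat) (x y : int) : bool :=
  match k with
  | 0 => if x == 0 then 0 <= y <= ((w3 - y) %% w2)%Z
         else [&& 0 < x, 2 * x <= w2, 0 <= y <= w2 - x & (w2 == w3) ==> (x <= y)]
  | 1 => [&& w2 < w3, 2 * x < w2 & 0 < y < x]
  | 2 => [&& x == 0, 0 <= y & 2 * y <= w2]
  | 3 => [&& 0 < x <= w2, w3 - w2 <= y <= w3 & (w2 == w3) ==> (x <= y)]
  | 4 => [&& 0 < y, y < x, x < w2 & (w2 == w3) ==> (y <= w2 - x)]
  | _ => false
  end.

Lemma nf_snd0_lt w2 w3 y : 0 < w2 -> 0 <= y <= ((w3 - y) %% w2)%Z -> 0 <= y < w2.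
Proof.
by move=> w2_gt0 /andP[-> h]; have := @ltz_pmod (w3 - y) _ w2_gt0; lia.
Qed.

Lemma nf_reduced w2 w3 k x y : 0 < w2 <= w3 -> nf_valid w2 w3 k x y ->
  let v := nf_snd w2 w3 k x y in
  reduced (nf_triangular k) w2 x v.1 v.2 w2 w3.
Proof.
move=> hw; rewrite /reduced /hnorm /nf_triangular.
case: k => [|[|[|[|[|//]]]]] /=; last 4 first.
- by split; lia.
- by split; lia.
- by split; lia.
- by split; lia.
have [->|x0] := eqVneq x 0; last by split; lia.
move=> h; have hy : 0 <= y < w2 by apply: nf_snd0_lt h; lia.
by split; lia.
Qed.

Lemma reducedNl t a b c d w2 w3 :
  reduced t a b c d w2 w3 -> reduced t (- a) (- b) c d w2 w3.
Proof. by rewrite /reduced hnorm_opp !opprK => -[]. Qed.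

(* In the triangular case [0, u.1, u.2] are the values of a functional at the
   vertices; sorting them leaves the choice of placing the middle one in the lower half. *)
Lemma rho_normalize t (u : int * int) w : hnorm t u.1 u.2 = w -> exists e s1 s2 s3,
  let u' := rho t s1 s2 s3 (e * u.1, e * u.2) in
  [/\ e \in [:: 1; -1], u'.1 = w, 0 <= u'.2 & if t then 2 * u'.2 <= w else u'.2 <= w].
Proof.
case: u => x y /=; rewrite /hnorm; case: t => <-; last first.
  exists 1, (`|x| < `|y|), (x < 0), (y < 0).
  by case: (ltP `|x| `|y|); case: (ltP x 0); case: (ltP y 0) => /=; split => //; lia.
have [x0|x0] := leP 0 x; have [y0|y0] := leP 0 y; have [xy|xy] := leP x y;
  have [m1|m1] := leP (2 * x) y; have [m2|m2] := leP (2 * y) x; have [m3|m3] := leP 0 (x + y);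
  try lia; first
  [ by exists 1, false, false, false; move=> /=; split; [|lia..]
  | by exists 1, false, true, false; move=> /=; split; [|lia..]
  | by exists 1, false, false, true; move=> /=; split; [|lia..]
  | by exists 1, true, false, false; move=> /=; split; [|lia..]
  | by exists 1, true, true, false; move=> /=; split; [|lia..]
  | by exists 1, true, false, true; move=> /=; split; [|lia..]
  | by exists (-1), false, false, false; move=> /=; split; [|lia..]
  | by exists (-1), false, true, false; move=> /=; split; [|lia..]
  | by exists (-1), false, false, true; move=> /=; split; [|lia..]
  | by exists (-1), true, false, false; move=> /=; split; [|lia..]
  | by exists (-1), true, true, false; move=> /=; split; [|lia..]
  | by exists (-1), true, false, true; move=> /=; split; [|lia..]].
Qed.

(** Linear alternatives for case analysis; the last one stems from the 0 inside [hnorm] when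
    [t = false]. *)
Lemma hnorm_geP t x y w : w <= hnorm t x y ->
  [\/ w <= x \/ w <= - x, w <= y \/ w <= - y | t /\ (w <= x - y \/ w <= y - x)] \/ w <= 0.
Proof.
rewrite /hnorm; case: t; rewrite !le_max => h.
  case/orP: h => [/orP[h|h]|h]; left; [constructor 1|constructor 2|constructor 3]; lia.
case/orP: h => [/orP[h|h]|h]; last by right.
  by left; constructor 1; lia.
by left; constructor 2; lia.
Qed.

(** * Existence of normal forms *)

Section NormalForms.
Variable R : realType.
Local Notation "P ~~ Q" := (@affine_equiv R 3 P Q) (at level 70).
Local Notation T t u v := (lhull R (tet t u v)).

Variables w2 w3 : int.
Hypothesis hw : 0 < w2 <= w3.

Definition nf (k : nat) (x y : int) : set 'cV[R]_3 :=
  T (nf_triangular k) (w2, x) (nf_snd w2 w3 k x y).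

Let normalizable (t : bool) u v := exists k x y,
  nf_valid w2 w3 k x y /\ T t u v ~~ nf k x y.

Let norm_nf t k x y : nf_valid w2 w3 k x y -> nf_triangular k = t ->
  normalizable t (w2, x) (nf_snd w2 w3 k x y).
Proof. by move=> h <-; exists k, x, y; split => //; exact: affine_equiv_refl. Qed.

Let norm_step (m n k l : int) (s1 s2 s3 : bool) t u v u' v' :
  m * l - n * k \in [:: 1; -1] ->
  u' = rho t s1 s2 s3 (lin2 m n u v) -> v' = rho t s1 s2 s3 (lin2 k l u v) ->
  normalizable t u' v' -> normalizable t u v.
Proof.
move=> hd eu ev [k0 [x [y [hv h]]]]; exists k0, x, y; split => //.
apply: affine_equiv_trans h; apply: congr_tet_equiv.
by exists m, n, k, l, s1, s2, s3.
Qed.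

(* The four integers are the row operation, the booleans the column symmetry applied after it, and
   the last two arguments the resulting rows. *)
Tactic Notation "step" uconstr(m) uconstr(n) uconstr(k) uconstr(l)
    constr(s1) constr(s2) constr(s3) uconstr(u) uconstr(v) :=
  refine (@norm_step m n k l s1 s2 s3 _ _ _ u v _ _ _ _);
  [by rewrite !inE; lia | by rewrite /rho /lin2 /=; congr pair; try ring; lia
   | by rewrite /rho /lin2 /=; congr pair; try ring; lia |].

(** Adding multiples of [(w2, 0)] reduces [c] modulo [w2], and a symmetry of the triangle replaces
    the residue [y] by that of [w3 - y]. The smaller of the two is the normal form. *)
Let norm_tri0 (c d : int) : `|d| = w3 -> normalizable true (w2, 0) (c, d).
Proof.
move=> hd.
wlog -> : c d hd / d = w3 => [th|].
  have [d0|d0] := leP 0 d; first by apply: th; lia.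
  by step 1 0 0 (-1) false false false (w2, 0) (- c, - d); apply: th; lia.
have [w2_neq0 w2_gt0] : w2 != 0 /\ 0 < w2 by lia.
have := divz_eq c w2; have := modz_ge0 c w2_neq0; have := @ltz_pmod c w2 w2_gt0.
move: (c %/ w2)%Z (c %% w2)%Z => q y yw y0 cE.
have [h|h] := leP y ((w3 - y) %% w2)%Z.
  step 1 0 (- q) 1 false false false (w2, 0) (y, w3).
  by apply: (@norm_nf true 0 0 y) => //=; rewrite y0.
pose z := ((w3 - y) %% w2)%Z; pose q' := ((w3 - y) %/ w2)%Z.
have zE : w3 - y = q' * w2 + z by exact: divz_eq.
have z0 : 0 <= z by exact: modz_ge0.
step 1 0 (q - q') (-1) false false true (w2, 0) (z, w3).
apply: (@norm_nf true 0 0 z) => //=; rewrite z0 /=.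
have -> : w3 - z = q' * w2 + y by lia.
by rewrite modzMDl modz_small; lia.
Qed.

(** If [w2 = w3], exchanging both the rows and the columns swaps [x] and [y], so [x <= y] can be
    arranged unless [y = 0], which leads to the case [x = 0]. *)
Let norm_tri x y : 0 < x -> 2 * x <= w2 -> 0 <= y <= w2 - x ->
  normalizable true (w2, x) (y, w3).
Proof.
move=> x0 xw hy; have [/andP[/eqP e yx]|h] := boolP ((w2 == w3) && (y < x)); last first.
  by apply: (@norm_nf true 0 x y) => //=; rewrite (negPf (_ : x != 0)) //; lia.
rewrite -e.
have [y0|y0] := eqVneq y 0; last first.
  step 0 1 1 0 true false false (w2, y) (x, w3).
  by apply: (@norm_nf true 0 y x) => //=; rewrite (negPf y0); lia.
step 0 1 1 0 true false false (w2, 0) (x, w3).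
by apply: norm_tri0; lia.
Qed.

Let norm_tri_reduced x v : 0 <= x -> 2 * x <= w2 -> reduced true w2 x v.1 v.2 w2 w3 ->
  normalizable true (w2, x) v.
Proof.
case: v => c d /= x0 xw; rewrite /reduced => -[_ hc /hnorm_geP hp /hnorm_geP hm].
have := lexx w3; rewrite -{2}hc => /hnorm_geP.
have : hnorm true c d <= w3 by rewrite hc.
rewrite hnorm_leP /= => /and3P[uc ud ucd] hc'.
have {hc'} ext : [\/ c = w3 \/ - c = w3, d = w3 \/ - d = w3 | d - c = w3 \/ c - d = w3].
  by case: hc' => [[]|]; [constructor 1|constructor 2|constructor 3|]; lia.
have {}hp : [\/ w3 <= c + w2 \/ w3 <= - (c + w2), w3 <= d + x \/ w3 <= - (d + x) |
    w3 <= c + w2 - (d + x) \/ w3 <= d + x - (c + w2)].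
  by case: hp => [[?|?|[_ ?]]|]; [constructor 1|constructor 2|constructor 3|lia].
have {}hm : [\/ w3 <= c - w2 \/ w3 <= - (c - w2), w3 <= d - x \/ w3 <= - (d - x) |
    w3 <= c - w2 - (d - x) \/ w3 <= d - x - (c - w2)].
  by case: hm => [[?|?|[_ ?]]|]; [constructor 1|constructor 2|constructor 3|lia].
have [x_eq0|xn0] := eqVneq x 0.
  rewrite x_eq0; apply: norm_tri0.
  by case: ext => -[] ?; case: hp => -[] ?; case: hm => -[] ?; lia.
(* An extreme [c] is impossible when [0 < x]: adding or subtracting the first row would make the
   second one strictly shorter. *)
have : [\/ d = w3 /\ 0 <= c <= w2 - x, - d = w3 /\ 0 <= - c <= w2 - x,
    d - c = w3 /\ 0 <= - c <= x | c - d = w3 /\ 0 <= c <= x].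
  case: ext => -[] ext; [exfalso|exfalso|constructor 1|constructor 2|constructor 3|constructor 4];
    case: hp => -[] ?; case: hm => -[] ?; lia.
(* The family [k = 1] lives in the interior: at [y = 0], [y = x], [2 x = w2] or [w2 = w3] an
   operation leads back to the family [k = 0]. *)
have third y : 0 <= y <= x -> normalizable true (w2, x) (- y, w3 - y).
  move=> hy; have [y_eq0|y0] := eqVneq y 0.
    by rewrite y_eq0 oppr0 subr0; apply: norm_tri; lia.
  have [y_eq|yx] := eqVneq y x.
    step 1 0 1 1 false false false (w2, x) (w2 - x, w3).
    by apply: norm_tri; lia.
  have [xE|x_lt] := eqVneq (2 * x) w2.
    step (-1) 0 0 1 false true false (w2, x) (y, w3).
    by apply: norm_tri; lia.
  have [e|ne] := eqVneq w2 w3.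
    step 0 1 (-1) 0 true true false (w2, y) (w2 - x, w3).
    by apply: norm_tri; lia.
  by apply: (@norm_nf true 1 x y) => //=; lia.
case=> -[h1 h2].
- by rewrite h1; apply: norm_tri; lia.
- by step 1 0 0 (-1) false false false (w2, x) (- c, w3); apply: norm_tri; lia.
- rewrite (_ : (c, d) = (- - c, w3 - - c)); last by congr pair; lia.
  exact: third.
- by step 1 0 0 (-1) false false false (w2, x) (- c, w3 - c); apply: third; lia.
Qed.

(** Reversing the first edge replaces the residue [y] of [c] modulo [w2] by [w2 - y], hence the
    bound [2 y <= w2]. *)
Let norm_rect0 (c d : int) : `|d| = w3 -> normalizable false (w2, 0) (c, d).
Proof.
move=> hd.
wlog -> : c d hd / d = w3 => [th|].
  have [d0|d0] := leP 0 d; first by apply: th; lia.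
  by step 1 0 0 (-1) false false false (w2, 0) (- c, - d); apply: th; lia.
have [w2_neq0 w2_gt0] : w2 != 0 /\ 0 < w2 by lia.
have := divz_eq c w2; have := modz_ge0 c w2_neq0; have := @ltz_pmod c w2 w2_gt0.
move: (c %/ w2)%Z (c %% w2)%Z => q y yw y0 cE.
have [h|h] := leP (2 * y) w2.
  step 1 0 (- q) 1 false false false (w2, 0) (y, w3).
  by apply: (@norm_nf false 2 0 y) => //=; lia.
step (-1) 0 (- (q + 1)) 1 false true false (w2, 0) (w2 - y, w3).
by apply: (@norm_nf false 2 0 (w2 - y)) => //=; lia.
Qed.

Let norm_rect x y : 0 < x <= w2 -> w3 - w2 <= y <= w3 ->
  normalizable false (w2, x) (y, - w3).
Proof.
move=> hx hy; have [/andP[/eqP e yx]|h] := boolP ((w2 == w3) && (y < x)); last first.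
  by apply: (@norm_nf false 3 x y) => //=; lia.
have [y0|y0] := eqVneq y 0; last first.
  step 0 1 (-1) 0 true false true (w2, y) (x, - w3).
  by apply: (@norm_nf false 3 y x) => //=; lia.
step 0 1 (-1) 0 true false true (w2, 0) (x, - w3).
by apply: norm_rect0; lia.
Qed.

Let norm_rect_reduced x v : 0 <= x <= w2 -> reduced false w2 x v.1 v.2 w2 w3 ->
  normalizable false (w2, x) v.
Proof.
case: v => c d /= hx; rewrite /reduced => -[_ hc /hnorm_geP hp /hnorm_geP hm].
have := lexx w3; rewrite -{2}hc => /hnorm_geP.
have : hnorm false c d <= w3 by rewrite hc.
rewrite hnorm_leP /= => /and3P[uc ud _] hc'.
have {hc'} ext : (c = w3 \/ - c = w3) \/ (d = w3 \/ - d = w3).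
  by case: hc' => [[?|?|[]//]|]; [left|right|]; lia.
have {}hp : (w3 <= c + w2 \/ w3 <= - (c + w2)) \/ (w3 <= d + x \/ w3 <= - (d + x)).
  by case: hp => [[?|?|[]//]|]; [left|right|lia].
have {}hm : (w3 <= c - w2 \/ w3 <= - (c - w2)) \/ (w3 <= d - x \/ w3 <= - (d - x)).
  by case: hm => [[?|?|[]//]|]; [left|right|lia].
have [x_eq0|xn0] := eqVneq x 0.
  rewrite x_eq0; apply: norm_rect0.
  by case: ext => -[] ?; case: hp => -[] ?; case: hm => -[] ?; lia.
(* If [d = - w3] and [0 < x], adding the first row makes the second entry shorter than [w3], so
   reducedness forces [c + w2 >= w3]. *)
have : [\/ d = - w3 /\ w3 - w2 <= c <= w3, - d = - w3 /\ w3 - w2 <= - c <= w3,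
    c = w3 /\ 0 < d + w3 <= x | - c = w3 /\ 0 < - d + w3 <= x].
  have [dw|dw] := eqVneq `|d| w3.
    suff : (d = - w3 /\ w3 - w2 <= c) \/ (- d = - w3 /\ w3 - w2 <= - c).
      by case=> -[? ?]; [constructor 1|constructor 2]; lia.
    case: ext => -[] ?; case: hp => -[] ?; case: hm => -[] ?; lia.
  case: ext => -[] ext; [constructor 3|constructor 4|exfalso|exfalso];
    case: hp => -[] ?; case: hm => -[] ?; lia.
(* The borders [x = w2] and [y = x] belong to the family [k = 3]; for [w2 = w3] the exchange of the
   rows sends [(x, y)] to [(w2 - y, w2 - x)]. *)
have fourth y : 0 < y <= x -> normalizable false (w2, x) (w3, y - w3).
  move=> hy; have [xE|xw] := eqVneq x w2.
    step 1 0 0 (-1) true false false (w2, x) (w3 - y, - w3).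
    by apply: norm_rect; lia.
  have [yE|yx] := eqVneq y x.
    step 1 0 (-1) 1 false false false (w2, x) (w3 - w2, - w3).
    by apply: norm_rect; lia.
  have [/andP[/eqP e yx']|h] := boolP ((w2 == w3) && (w2 - x < y)); last first.
    by apply: (@norm_nf false 4 x y) => //=; lia.
  step 0 1 1 0 false false true (w2, w2 - y) (w3, (w2 - x) - w3).
  by apply: (@norm_nf false 4 (w2 - y) (w2 - x)) => //=; lia.
case=> -[h1 h2].
- by rewrite h1; apply: norm_rect; lia.
- by step 1 0 0 (-1) false false false (w2, x) (- c, - w3); apply: norm_rect; lia.
- rewrite (_ : (c, d) = (w3, (d + w3) - w3)); last by congr pair; lia.
  exact: fourth.
- by step 1 0 0 (-1) false false false (w2, x) (w3, (- d + w3) - w3); apply: fourth; lia.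
Qed.

Lemma reduced_normal_form t u v : reduced t u.1 u.2 v.1 v.2 w2 w3 ->
  exists k x y, nf_valid w2 w3 k x y /\ T t u v ~~ nf k x y.
Proof.
move=> red; have [hu _ _ _] := red.
have [e [s1 [s2 [s3 [he h1 h2 h3]]]]] : exists e s1 s2 s3,
    let u' := rho t s1 s2 s3 (e * u.1, e * u.2) in
    [/\ e \in [:: 1; -1], u'.1 = w2, 0 <= u'.2 & if t then 2 * u'.2 <= w2 else u'.2 <= w2].
  exact: rho_normalize.
have redN : reduced t (e * u.1) (e * u.2) v.1 v.2 w2 w3.
  by move: he; rewrite !inE => /orP[]/eqP->; rewrite ?mul1r ?mulN1r //; exact: reducedNl.
have := @reduced_rho t s1 s2 s3 (e * u.1, e * u.2) v _ _ redN.
move=> red'; rewrite -/(normalizable t u v).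
apply: (@norm_step e 0 0 1 s1 s2 s3 t u v _ _ _ erefl erefl).
  by move: he; rewrite !inE mulr1 mulr0 subr0.
rewrite (_ : lin2 e 0 u v = (e * u.1, e * u.2)); last by rewrite /lin2; congr pair; ring.
rewrite (_ : lin2 0 1 u v = v); last by case: (v) => ? ?; rewrite /lin2; congr pair => /=; ring.
move: (rho t s1 s2 s3 (_ , _)) h1 h2 h3 red' => -[p x] /= -> x0 xw.
move: (rho t s1 s2 s3 v) => v'; clear - hw norm_tri_reduced norm_rect_reduced x0 xw.
case: t xw => xw red'; first exact (norm_tri_reduced x0 xw red').
by refine (@norm_rect_reduced x v' _ red'); rewrite x0.
Qed.

End NormalForms.

(** * Uniqueness of normal forms *)

(** A vanishing determinant would produce a nontrivial combination of the rows equal to zero,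
    against the lower bound [w2] on its norm. *)
Lemma reduced_cross t u v w2 w3 : 0 < w2 <= w3 ->
  reduced t u.1 u.2 v.1 v.2 w2 w3 -> cross u v != 0.
Proof.
move=> hw red; apply/eqP => uv0.
have vanish m n : m * u.1 + n * v.1 = 0 -> m * u.2 + n * v.2 = 0 -> m = 0 /\ n = 0.
  move=> h1 h2; have := reduced_gt0 (m := m) (n := n) red hw; rewrite h1 h2.
  have [->|_] := eqVneq m 0; have [->|_] := eqVneq n 0 => //= /(_ isT);
    by rewrite /hnorm; case: (t); lia.
have [|| v1 u1] := vanish (- v.1) u.1; [ring| move: uv0; rewrite /cross; lia|].
have [|| v2 u2] := vanish (- v.2) u.2; [move: uv0; rewrite /cross; lia|ring|].
have [] := vanish 1 0; lia.
Qed.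

(** * From affine equivalence back to congruence of matrices *)

Section EquivCongr.
Variable R : realType.

(** The height of the image, pulled back, takes values 0 and 1 on the vertices. Its part [(m, n)] in
    the other coordinates thus has norm at most 1, below [w2], and vanishes; so the map respects the
    pairs of planes. *)
Lemma equiv_congr_tet t u v t' u' v' w2 w3 : 1 < w2 <= w3 ->
  reduced t u.1 u.2 v.1 v.2 w2 w3 ->
  affine_equiv (lhull R (tet t u v)) (lhull R (tet t' u' v')) ->
  t = t' /\ congr_tet t u v u' v'.
Proof.
move=> hw red eqT; have hw' : 0 < w2 <= w3 by lia.
have cr := reduced_cross hw' red.
have [|A [b [s [uA sE]]]] := affine_equiv_vertices _ eqT.
  by rewrite -normr_gt0 vol_tet normr_gt0.
have dA : \det A \in [:: 1; -1] by case/orP: uA => /eqP ->.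
move: sE dA; rewrite det_mx3 (mx3E A) (ptE b) !mxE /=; clear uA.
move: (A o0 o0) (A o0 o1) (A o0 o2) (A o1 o0) (A o1 o1) (A o1 o2) (A o2 o0) (A o2 o1) (A o2 o2).
move: (b o0 0) (b o1 0) (b o2 0) => b0 b1 b2 c m n c1 m1 n1 c2 m2 n2 sE dA.
have : exists j0 j1 j2 j3 : 'I_4, uniq [:: j0; j1; j2; j3] /\
   (let F i j := mx3 c m n c1 m1 n1 c2 m2 n2 *m tet t u v i + pt b0 b1 b2 = tet t' u' v' j in
   [/\ F (@Ordinal 4 0 isT) j0, F (@Ordinal 4 1 isT) j1, F (@Ordinal 4 2 isT) j2 &
       F (@Ordinal 4 3 isT) j3]).
  exists (s (@Ordinal 4 0 isT)), (s (@Ordinal 4 1 isT)), (s (@Ordinal 4 2 isT)), (s (@Ordinal 4 3 isT)).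
  split; last by split; apply: sE.
  by rewrite -[[:: _; _; _; _]]/(map s [:: _; _; _; _]) map_inj_uniq //; apply: perm_inj.
clear sE s b A eqT => -[j0 [j1 [j2 [j3 [juniq [e0 e1 e2 e3]]]]]].
have height j : exists2 h, 0 <= h <= 1 & exists y z, tet t' u' v' j = pt h y z.
  rewrite /tet; case: (t'); case: j => -[|[|[|[|//]]]] hj; rewrite /vs /=;
    by (exists 0 => //; do 2!eexists; reflexivity) || (exists 1 => //; do 2!eexists; reflexivity).
have [m0 n0] : m = 0 /\ n = 0.
  have hmn : hnorm t (m * u.1 + n * v.1) (m * u.2 + n * v.2) <= 1.
    move: e0 e1 e2 e3; have [h0 hh0 [y0 [z0 ->]]] := height j0.
    have [h1 hh1 [y1 [z1 ->]]] := height j1; have [h2 hh2 [y2 [z2 ->]]] := height j2.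
    have [h3 hh3 [y3 [z3 ->]]] := height j3.
    rewrite hnorm_leP /tet; case: (t); rewrite /vs /= !mx3_pt !ptD;
      by move=> /pt_inj[? _ _] /pt_inj[? _ _] /pt_inj[? _ _] /pt_inj[? _ _]; lia.
  have [/(reduced_gt0 red hw')|] := boolP ((m != 0) || (n != 0)); first lia.
  by rewrite negb_or !negbK => /andP[/eqP-> /eqP->].
rewrite {}m0 {}n0 {height} in dA e0 e1 e2 e3.
have [hc hd] : c \in [:: 1; -1] /\ m1 * n2 - n1 * m2 \in [:: 1; -1].
  have : c * (m1 * n2 - n1 * m2) \in [:: 1; -1].
    by move: dA; rewrite !mul0r subr0 addr0.
  rewrite !inE; move: (m1 * _ - _) => D cD.
  have /eqP : (`|c| * `|D|)%N = 1%N by rewrite -abszM; case/orP: cD => /eqP ->.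
  by rewrite muln_eq1 => /andP[/eqP ? /eqP ?]; lia.
clear dA red cr hw hw' w2 w3.
suff hrho : t = t' /\ exists s1 s2 s3, u' = rho t s1 s2 s3 (lin2 m1 n1 u v) /\
    v' = rho t s1 s2 s3 (lin2 m2 n2 u v).
  case: hrho => ? [s1 [s2 [s3 [? ?]]]]; split => //.
  by exists m1, n1, m2, n2, s1, s2, s3.
clear hd; move: hc; rewrite !inE => hc.
case: u v u' v' e0 e1 e2 e3 => p q [x y] [p' q'] [x' y'].
(* All vertex assignments are enumerated. Those that break the planes contradict the heights, which
   also excludes [t <> t']; each remaining one is a symmetry in [rho]. *)
case: t; case: t'; case: j0 juniq => -[|[|[|[|//]]]] ?; case: j1 => -[|[|[|[|//]]]] ? //=;
  case: j2 => -[|[|[|[|//]]]] ? //=; case: j3 => -[|[|[|[|//]]]] ? //= _;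
  rewrite /tet /vs /= !mx3_pt !ptD;
  move=> /pt_inj[h0 k0 l0] /pt_inj[h1 k1 l1] /pt_inj[h2 k2 l2] /pt_inj[h3 k3 l3];
  (exfalso; clear - hc h0 h1 h2 h3; lia) || (split => //);
  clear h0 h1 h2 h3;
  first
  [ by exists false, false, false; rewrite /rho /lin2 /=; split; congr pair; lia
  | by exists true, false, false; rewrite /rho /lin2 /=; split; congr pair; lia
  | by exists false, true, false; rewrite /rho /lin2 /=; split; congr pair; lia
  | by exists true, true, false; rewrite /rho /lin2 /=; split; congr pair; lia
  | by exists false, false, true; rewrite /rho /lin2 /=; split; congr pair; lia
  | by exists true, false, true; rewrite /rho /lin2 /=; split; congr pair; lia
  | by exists false, true, true; rewrite /rho /lin2 /=; split; congr pair; lia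
  | by exists true, true, true; rewrite /rho /lin2 /=; split; congr pair; lia ].
Qed.

End EquivCongr.

(** Replaces the product [k * w] by linear information: once the product is generalised to a
    variable, linear arithmetic decides each case. *)
Lemma mulz_trichotomy (k w : int) : 0 <= w ->
  [\/ k = 0 /\ k * w = 0, k = 1 /\ k * w = w, 2 <= k /\ 2 * w <= k * w |
      k = -1 /\ k * w = - w \/ k <= -2 /\ k * w <= - (2 * w)].
Proof.
move=> w0.
have [->|k0] := eqVneq k 0; first by constructor 1; rewrite mul0r.
have [->|k1] := eqVneq k 1; first by constructor 2; rewrite mul1r.
have [k2|k2] := leP 2 k; first by constructor 3; split=> //; nia.
constructor 4; have [->|k3] := eqVneq k (-1); first by left; rewrite mulN1r.
by right; split; nia.
Qed.

Lemma pair_inj (A B : Type) (p q : A * B) : p = q -> p.1 = q.1 /\ p.2 = q.2.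
Proof. by move=> ->. Qed.

Lemma nf_snd0_bound w y : 0 < w -> 0 <= y <= ((w - y) %% w)%Z -> 0 <= 2 * y <= w.
Proof.
move=> w0 /andP[y0]; have [->|yn0] := eqVneq y 0; first by rewrite subr0 modzz; lia.
have := @ltz_pmod (w - y) w w0 => lt le.
have yw : y < w by exact: le_lt_trans lt.
by move: le; rewrite modz_small; lia.
Qed.

Lemma nf_fst_range w2 w3 k x y : 0 < w2 -> nf_valid w2 w3 k x y ->
  0 <= x <= w2 /\ (nf_triangular k -> 2 * x <= w2).
Proof.
move=> hw; case: k => [|[|[|[|[|//]]]]] /=; last 4 first; try by rewrite /nf_triangular; lia.
by case: eqVneq => [->|_]; lia.
Qed.

(** The new first row has norm [w2 < w3], so it does not involve the old second row. The determinant
    then makes the diagonal coefficients signs, and only the multiple [p] of the first row remains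
    unknown. *)
Lemma nf_unique_lt w2 w3 k x y k' x' y' : 0 < w2 < w3 ->
  nf_valid w2 w3 k x y -> nf_valid w2 w3 k' x' y' ->
  nf_triangular k = nf_triangular k' ->
  congr_tet (nf_triangular k) (w2, x) (nf_snd w2 w3 k x y)
    (w2, x') (nf_snd w2 w3 k' x' y') ->
  [/\ k = k', x = x' & y = y'].
Proof.
move=> hw hv hv' ht [m [n [p [l [s1 [s2 [s3 [hd eu ev]]]]]]]].
have hw' : 0 < w2 <= w3 by lia.
have w2_gt0 : 0 < w2 by lia.
have n0 : n = 0.
  have := nf_reduced hw' hv => /= red; have := nf_reduced hw' hv' => /= -[hu _ _ _].
  apply/eqP; apply: contraTT isT => n0; have := reduced_ge m red hw' n0.
  have := hnorm_rho (nf_triangular k) s1 s2 s3 (lin2 m n (w2, x) (nf_snd w2 w3 k x y)).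
  by rewrite -eu /= => <-; rewrite ht hu; lia.
have {hd} [hm hl] : (m = 1 \/ m = -1) /\ (l = 1 \/ l = -1).
  move: hd; rewrite n0 mul0r subr0 !inE => ml.
  have /eqP : (`|m| * `|l|)%N = 1%N by rewrite -abszM; case/orP: ml => /eqP ->.
  by rewrite muln_eq1 => /andP[/eqP ? /eqP ?]; lia.
move: eu ev; rewrite /lin2 n0 /= !mul0r !addr0 => eu ev.
have x0 : 0 <= x by have [] := nf_fst_range w2_gt0 hv; lia.
have w20 : 0 <= w2 by lia.
have x'E : x' = x.
  have [xw xt] := nf_fst_range w2_gt0 hv; have [xw' xt'] := nf_fst_range w2_gt0 hv'; rewrite ht in xt.
  move: xt xt'.
  move: eu; rewrite /rho ht; clear - hm hw xw xw'.
  by case: hm => ->; case: (nf_triangular k'); case: s1; case: s2; case: s3 => /pair_inj[/= ? ?]; lia.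
rewrite {}x'E in hv' eu ev *.
suff kyE : k = k' /\ y = y' by case: kyE.
have [x_eq0|xn0] := eqVneq x 0.
  move: eu ev hv hv' ht; rewrite {}x_eq0 mulr0 add0r.
  case: k => [|[|[|[|[|//]]]]]; case: k' => [|[|[|[|[|//]]]]];
    rewrite /nf_triangular //= => eu ev hv hv' _; try by exfalso; lia.
    split=> //; have yw := nf_snd0_lt w2_gt0 hv; have yw' := nf_snd0_lt w2_gt0 hv'.
    (* The compatible symmetries keep the residue of [y] modulo [w2] or turn it into that of
       [w3 - y]. In the second case the residue conditions on [y] and on [y'] give both inequalities
       between them. *)
    have : y' = p * w2 + y \/ y' = p * w2 + (w3 - y).
      move: eu ev; clear - hm hl hw yw yw'; move: (p * w2) => P.
      by case: hm => ->; case: hl => ->; case: s1; case: s2; case: s3;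
      move=> /pair_inj[/= ? ?] /pair_inj[/= ? ?]; lia.
    case=> yE; first by have := modzMDl p y w2; rewrite -yE !modz_small.
    have yE' : w3 - y' = (- p) * w2 + y by rewrite yE; ring.
    move: hv hv'; rewrite yE' modzMDl (modz_small yw).
    have -> : w3 - y = (- p) * w2 + y' by rewrite yE; ring.
    by rewrite modzMDl (modz_small yw'); lia.
  split=> //; move: eu ev; have := mulz_trichotomy p (ltW w2_gt0); move: (p * w2) => P tw.
  clear - hm hl hw tw hv hv'.
  by case: hm => ->; case: hl => ->; case: s1; case: s2; case: s3;
      move=> /pair_inj[/= ? ?] /pair_inj[/= ? ?]; try lia;
    case: tw => [?|?|?|[?|?]]; lia.
have tx := mulz_trichotomy p x0; have tw := mulz_trichotomy p w20.
move: (p * w2) (p * x) tx tw eu ev => P X tx tw eu ev.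
have {}tx : [\/ p = 0 /\ P = 0 /\ X = 0, p = 1 /\ P = w2 /\ X = x,
    2 <= p /\ 2 * w2 <= P /\ 2 * x <= X |
    p = -1 /\ P = - w2 /\ X = - x \/ p <= -2 /\ P <= - (2 * w2) /\ X <= - (2 * x)].
  by case: tx => [?|?|?|[?|?]]; case: tw => [?|?|?|[?|?]];
    try lia; [constructor 1|constructor 2|constructor 3|constructor 4; left|constructor 4; right]; lia.
clear tw.
move: eu ev ht hv hv'; rewrite /nf_snd /nf_valid (negPf xn0) /nf_triangular /rho.
case: k => [|[|[|[|[|//]]]]]; case: k' => [|[|[|[|[|//]]]]] //=; case: hm => ->; case: hl => ->;
 case: s1; case: s2; case: s3;
      move=> /pair_inj[/= ? ?] /pair_inj[/= ? ?] _ hv hv'; try lia;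
 case: tx => [?|?|?|[?|?]]; lia.
Qed.

(** For equal widths neither row is distinguished by its norm, so the coefficients are bounded
    directly: each product is trapped between multiples of a nonnegative parameter. *)
Lemma nf_coeff_bound w k x y m n : 0 < w -> nf_valid w w k x y ->
  let v := nf_snd w w k x y in
  hnorm (nf_triangular k) (m * w + n * v.1) (m * x + n * v.2) <= w ->
  -1 <= m <= 1 /\ -1 <= n <= 1.
Proof.
move=> w_gt0 hv /=; rewrite hnorm_leP.
have [hx _] := nf_fst_range w_gt0 hv.
have x0 : 0 <= x by lia.
have tm := mulz_trichotomy m (ltW w_gt0); have tn := mulz_trichotomy n (ltW w_gt0).
have tx := mulz_trichotomy m x0.
have axis z : x = 0 -> 0 <= 2 * z <= w -> `|m * w + n * z| <= w -> `|m * x + n * w| <= w ->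
    -1 <= m <= 1 /\ -1 <= n <= 1.
  move=> -> hz h1 h2; have [n1 _] : -1 <= n <= 1 /\ True.
    by split=> //; case: tn h2 => [?|?|?|[?|?]]; lia.
  have : [\/ n = 0, n = 1 | n = -1].
    by have [->|?] := eqVneq n 0; [constructor 1|have [->|?] := eqVneq n 1;
      [constructor 2|constructor 3; lia]].
  by case=> nE; move: h1; rewrite nE; case: tm => [?|?|?|[?|?]]; lia.
move: hv; case: k => [|[|[|[|[|//]]]]]; rewrite /nf_triangular /=; try lia.
- have [xE|xn0] := eqVneq x 0.
    by move=> /(nf_snd0_bound w_gt0) hy /and3P[h1 h2 _]; apply: (axis y).
  rewrite eqxx /= => hv; have wx : 0 <= w - x by lia.
  have y0 : 0 <= y by lia.
  have wy : 0 <= w - y by lia.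
  have twx := mulz_trichotomy m wx; have tny := mulz_trichotomy n y0.
  have twy := mulz_trichotomy n wy.
  (* Written with [w - x] and [w - y], the third side involves only products with nonnegative
     factors. *)
  rewrite (_ : m * w + n * y - (m * x + n * w) = m * (w - x) - n * (w - y)); last by ring.
  move: tm tn tx twx tny twy; move: (m * w) (n * w) (m * x) (m * (w - x)) (n * y) (n * (w - y)).
  move=> ? ? ? ? ? ?; clear axis; do 3![case=> [?|?|?|[?|?]]; try lia];
    do 3![case=> [?|?|?|[?|?]]; try lia].
- by move=> hv /and3P[h1 h2 _]; apply: (axis y) => //; lia.
- rewrite eqxx /= => hv; have y0 : 0 <= y by lia.
  have tny := mulz_trichotomy n y0; rewrite mulrN.
  move: tm tn tx tny; move: (m * w) (n * w) (m * x) (n * y).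
  move=> ? ? ? ?; clear axis; do 3![case=> [?|?|?|[?|?]]; try lia];
    case=> [?|?|?|[?|?]]; lia.
- rewrite eqxx /= => hv; have wy : 0 <= w - y by lia.
  have twy := mulz_trichotomy n wy; rewrite -[y - w]opprB mulrN.
  move: tm tn tx twy; move: (m * w) (n * w) (m * x) (n * (w - y)).
  move=> ? ? ? ?; clear axis; do 3![case=> [?|?|?|[?|?]]; try lia];
    case=> [?|?|?|[?|?]]; lia.
Qed.

(** Both new rows have norm [w], so all four coefficients lie in -1, 0, 1; each choice together with
    a column symmetry is a linear system in [x], [y], [x'], [y']. *)
Lemma nf_unique_eq w k x y k' x' y' : 0 < w ->
  nf_valid w w k x y -> nf_valid w w k' x' y' ->
  nf_triangular k = nf_triangular k' ->
  congr_tet (nf_triangular k) (w, x) (nf_snd w w k x y)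
    (w, x') (nf_snd w w k' x' y') ->
  [/\ k = k', x = x' & y = y'].
Proof.
move=> w_gt0 hv hv' ht [m [n [p [l [s1 [s2 [s3 [hd eu ev]]]]]]]].
have hw : 0 < w <= w by lia.
have [hu' hv1 _ _] := nf_reduced hw hv'.
have [hm hn] : -1 <= m <= 1 /\ -1 <= n <= 1.
  apply: (nf_coeff_bound w_gt0 hv) => /=.
  have := hnorm_rho (nf_triangular k) s1 s2 s3 (lin2 m n (w, x) (nf_snd w w k x y)).
  by rewrite -eu /= => <-; rewrite ht hu'.
have [hp hl] : -1 <= p <= 1 /\ -1 <= l <= 1.
  apply: (nf_coeff_bound w_gt0 hv) => /=.
  have := hnorm_rho (nf_triangular k) s1 s2 s3 (lin2 p l (w, x) (nf_snd w w k x y)).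
  by rewrite -ev /= => <-; rewrite ht hv1.
have unit3 (i : int) : -1 <= i <= 1 -> i \in [:: 0; 1; -1] by rewrite !inE; lia.
(* Removes the residue: for [w2 = w3] that condition amounts to [2 y <= w]. *)
have lin k0 x0 y0 : nf_valid w w k0 x0 y0 -> 
    (if k0 is 0%N then if x0 == 0 then 0 <= 2 * y0 <= w
       else [&& 0 < x0, 2 * x0 <= w & x0 <= y0 <= w - x0]
     else nf_valid w w k0 x0 y0).
  case: k0 => //=; have [_|_] := eqVneq x0 0; first exact: nf_snd0_bound.
  by rewrite eqxx /=; lia.
move: (lin _ _ _ hv) (lin _ _ _ hv') => {}hv {}hv'; clear lin hu' hv1.
move: eu ev hd ht hv hv' (unit3 _ hm) (unit3 _ hn) (unit3 _ hp) (unit3 _ hl).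
rewrite /lin2 /=; clear - w_gt0.
case: k => [|[|[|[|[|//]]]]]; case: k' => [|[|[|[|[|//]]]]] //= eu ev hd _; rewrite ?ltxx //.
all: rewrite ?eqxx /= => hv hv'; rewrite !inE;
  do 2![case/or3P => /eqP ?]; subst;
  rewrite ?mul0r ?mul1r ?mulN1r ?add0r ?addr0 in eu; move: eu; rewrite /rho /=;
  case: s1 ev; case: s2; case: s3 => ev /pair_inj[/= ? ?];
  move: hv hv'; try (have [?|?] := eqVneq x 0); try (have [?|?] := eqVneq x' 0); move=> hv hv';
  try (by exfalso; lia).
all: rewrite inE !inE in hd; do 2![case/or3P => /eqP ?]; subst; try (by move: hd);
  case/pair_inj: ev => /= ? ?; clear hd; split => //; lia.
Qed.

(** * The classification *)

Section Representatives.
Variable R : realType.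
Local Notation "P ~~ Q" := (@affine_equiv R 3 P Q) (at level 70).

Definition rep_vertices (w2 w3 : int) (k : nat) (x y : int) : 'I_4 -> 'cV[int]_3 :=
  match k with
  | 0 => vs (pt 0 0 0) (pt 0 w2 y) (pt 0 x w3) (pt 1 0 0)
  | 1 => vs (pt 0 0 y) (pt 0 w2 0) (pt 0 x w3) (pt 1 0 0)
  | 2 => vs (pt 0 0 0) (pt 0 w2 y) (pt 1 0 0) (pt 1 x w3)
  | 3 => vs (pt 0 0 0) (pt 0 w2 y) (pt 1 0 w3) (pt 1 x 0)
  | _ => vs (pt 0 0 0) (pt 0 w2 w3) (pt 1 0 w3) (pt 1 x y)
  end.

Definition rep (w2 w3 : int) (k : nat) (x y : int) : set 'cV[R]_3 :=
  lhull R (rep_vertices w2 w3 k x y).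

Lemma rep_equiv_nf w2 w3 k x y : rep w2 w3 k x y ~~ @nf R w2 w3 k x y.
Proof.
rewrite /rep /nf /rep_vertices /nf_triangular /nf_snd.
case: k => [|[|[|[|k]]]].
- exact: affine_equiv_refl.
- by have := @lift3_1 R 0 1 0 y w2 0 x w3 0 0 isT; rewrite !add0r !subr0 ?sub0r.
- by have := @lift2_2 R 0 1 0 0 w2 y 0 0 x w3 isT; rewrite !add0r !subr0.
- by have := @lift2_2 R 0 1 0 0 w2 y 0 w3 x 0 isT; rewrite !add0r !subr0 ?sub0r.
- by have := @lift2_2 R 0 1 0 0 w2 w3 0 w3 x y isT; rewrite !add0r !subr0.
Qed.

Lemma at_height0_hull (p q r : 'cV[int]_2) (v : 'cV[R]_3) :
  convex_hull (at_height0 (convex_hull [set intmx R p; intmx R q; intmx R r]) `|` [set v]) =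
  convex_hull [set col_mx (0 : 'cV[R]_1) (intmx R p); col_mx (0 : 'cV[R]_1) (intmx R q);
    col_mx (0 : 'cV[R]_1) (intmx R r); v].
Proof.
have lift_affmap x : col_mx (0 : 'cV[R]_1) x =
    affmap (col_mx 0 1%:M : 'M[R]_(1 + 2, 2)) 0 x.
  by rewrite /affmap mul_col_mx mul0mx mul1mx addr0.
have -> : at_height0 (convex_hull [set intmx R p; intmx R q; intmx R r]) =
    affmap (col_mx 0 1%:M : 'M[R]_(1 + 2, 2)) 0 @` convex_hull [set intmx R p; intmx R q; intmx R r].
  by apply: eq_imagel => x _; rewrite lift_affmap.
by rewrite convex_hull_image convex_hullU !image_setU !image_set1 !lift_affmap.
Qed.

Lemma pt2_lift x y : col_mx (0 : 'cV[R]_1) (pt2 R x y) = pt3 R 0 x y.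
Proof.
apply/colP => i; rewrite [RHS]mxE mxE; case: split_ordP => j -> /=.
  by rewrite !mxE [j]ord1.
by rewrite !mxE; case: j => -[|[|//]] hj.
Qed.

Lemma hull_pyramid x0 y0 x1 y1 x2 y2 :
  convex_hull (at_height0 (convex_hull [set pt2 R x0 y0; pt2 R x1 y1; pt2 R x2 y2]) `|`
    [set pt3 R 1 0 0]) =
  lhull R (vs (pt 0 x0 y0) (pt 0 x1 y1) (pt 0 x2 y2) (pt 1 0 0)).
Proof. by rewrite at_height0_hull -!/(pt2 R _ _) !pt2_lift lhull_vs. Qed.

Lemma hull4 x0 y0 z0 x1 y1 z1 x2 y2 z2 x3 y3 z3 :
  convex_hull [set pt3 R x0 y0 z0; pt3 R x1 y1 z1; pt3 R x2 y2 z2; pt3 R x3 y3 z3] =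
  lhull R (vs (pt x0 y0 z0) (pt x1 y1 z1) (pt x2 y2 z2) (pt x3 y3 z3)).
Proof. by rewrite lhull_vs. Qed.

(* For w2 = 1 the family (2) is the single tetrahedron
   [flat_rectangle_pyramid], already represented in the family (1). *)
Definition rep_valid (w2 w3 : int) (p : nat * int * int) : bool :=
  nf_valid w2 w3 p.1.1 p.1.2 p.2 && ((1 < w2) || (p.1.1 != 2)).

Lemma tetrahedra_rep w2 w3 : 0 < w2 <= w3 ->
  tetrahedra R w2 w3 =
  [set rep w2 w3 p.1.1 p.1.2 p.2 | p in [set p | rep_valid w2 w3 p]].
Proof.
move=> hw; rewrite /tetrahedra /rep_valid; have [w2_gt1|w2_le1] := ltP 1 w2.
  apply/seteqP; split=> [T|T [[[k x] y] /= /andP[hv _] <-]].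
  - rewrite /= /triangles.
    case=> [[[[t [ht ->]]|[z [z0 z1 ->]]]|[y [z [hy hz yz ->]]]]|[y [z [z0 zy yw h ->]]]].
    + case: ht => [[[y [hy ->]]|[x [y [x0 xw hy yx ->]]]]|[x [y [w x1 xw hy ->]]]].
      * exists (0%N, 0, y); rewrite /= ?hull_pyramid //.
        by rewrite hy.
      * exists (0%N, x, y); rewrite /= ?hull_pyramid //.
        rewrite (negPf (_ : x != 0)); last lia.
        by rewrite andbT; apply/and4P; split => //; apply/implyP => /eqP.
      * exists (1%N, x, y); rewrite /= ?hull_pyramid //; lia.
    + by exists (2%N, 0, z); rewrite /= ?hull4 //; lia.
    + exists (3%N, y, z); rewrite /= ?hull4 //.
      by rewrite hy hz andbT; apply/implyP => /eqP /esym.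
    + exists (4%N, y, z); rewrite /= ?hull4 //.
      by rewrite z0 zy yw andbT; apply/implyP => /eqP /esym.
  - move: hv; case: k => [|[|[|[|[|//]]]]] /=.
    + have [->|xn0] := eqVneq x 0 => hv.
        do 3!left; eexists; split; last by rewrite /rep -hull_pyramid; reflexivity.
        by left; left; exists y.
      do 3!left; eexists; split; last by rewrite /rep -hull_pyramid; reflexivity.
      by left; right; exists x, y; split => //; lia.
    + move=> hv; do 3!left; eexists; split; last by rewrite /rep -hull_pyramid; reflexivity.
      by right; exists x, y; split => //; lia.
    + move=> /and3P[/eqP-> h1 h2]; left; left; right; exists y.
      by split => //; rewrite hull4.
    + move=> hv; left; right; exists x, y; split; try lia.
      by rewrite hull4.
    + move=> hv; right; exists x, y; split; try lia.
      by rewrite hull4.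
(* Now validity leaves [k = 0] with [x = y = 0] and [k = 3] with [x = 1] and [y] equal to [w3 - 1]
   or [w3]; for [w3 = 1] the tie-break [x <= y] removes the first of these two values. *)
have w2E : w2 = 1 by lia.
have perm4 : lhull R (vs (pt 0 0 0) (pt 1 0 0) (pt 0 1 0) (pt 0 0 1)) =
    lhull R (vs (pt 0 0 0) (pt 0 1 0) (pt 0 0 1) (pt 1 0 0)).
  by rewrite lhull_swap12 lhull_swap23.
rewrite {}w2E in hw *; have [w3_gt1|w3_le1] := ltP 1 w3.
  apply/seteqP; split=> [T /= [[->|->]|->]|T [[[k x] y] /= hv <-]].
  - by exists (0%N, 0, 0); rewrite /= ?hull4 //; rewrite modz1.
  - by exists (3%N, 1, w3 - 1); rewrite /= ?hull4 //; lia.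
  - by exists (3%N, 1, w3); rewrite /= ?hull4 //; lia.
  - move: hv; case: k => [|[|[|[|[|//]]]]] /=; rewrite ?modz1 ?andbF //; try lia.
    + case: eqVneq => [->|_]; last lia.
      by move=> hv; rewrite (_ : y = 0); [left; left; rewrite hull4|lia].
    + move=> hv; have -> : x = 1 by lia.
      have [->|yw] := eqVneq y w3; first by right; rewrite hull4.
      by rewrite (_ : y = w3 - 1); [left; right; rewrite hull4|lia].
have -> : w3 = 1 by lia.
apply/seteqP; split=> [T /= [->|->]|T [[[k x] y] /= hv <-]].
- by exists (0%N, 0, 0); rewrite /= ?hull4 ?perm4.
- by exists (3%N, 1, 1); rewrite /= ?hull4.
- move: hv; case: k => [|[|[|[|[|//]]]]] /=; rewrite ?modz1 ?andbF //; try lia.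
  + case: eqVneq => [->|_]; last lia.
    by move=> hv; rewrite (_ : y = 0); [left; rewrite hull4 perm4|lia].
  + move=> hv; have [-> ->] : x = 1 /\ y = 1 by clear - hv; lia.
    by right; rewrite hull4.
Qed.

End Representatives.

(** * The bijection between representatives and equivalence classes *)

Section Classification.
Variable R : realType.
Local Notation "P ~~ Q" := (@affine_equiv R 3 P Q) (at level 70).
Local Notation rep := (@rep R).

Lemma cross_nf w2 w3 k x y : 0 < w2 <= w3 -> nf_valid w2 w3 k x y ->
  cross (w2, x) (nf_snd w2 w3 k x y) != 0.
Proof. by move=> hw hv; exact: (@reduced_cross _ (w2, x) _ w2 w3 hw (nf_reduced hw hv)). Qed.

Lemma rep_lattice_mwidth w2 w3 k x y : 0 < w2 <= w3 -> nf_valid w2 w3 k x y ->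
  lattice_tetrahedron (rep w2 w3 k x y) /\
  is_mwidth (rep w2 w3 k x y) [tuple 1; w2%:~R; w3%:~R].
Proof.
move=> hw hv; have /affine_equiv_sym nfE := rep_equiv_nf R w2 w3 k x y.
have lat := lattice_tet R (nf_triangular k) (cross_nf hw hv).
split; first exact: lattice_simplex_equiv nfE lat.
apply: is_mwidth_equiv nfE lat _.
exact: (@reduced_mwidth R _ (w2, x) (nf_snd w2 w3 k x y) w2 w3 hw (nf_reduced hw hv)).
Qed.

Lemma rep_equiv_inj w2 w3 p q : 0 < w2 <= w3 ->
  rep_valid w2 w3 p -> rep_valid w2 w3 q ->
  rep w2 w3 p.1.1 p.1.2 p.2 ~~ rep w2 w3 q.1.1 q.1.2 q.2 -> p = q.
Proof.
case: p q => [[k x] y] [[k' x'] y'] hw /= /andP[/= hv hk] /andP[/= hv' hk'] eqr.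
have eqnf : @nf R w2 w3 k x y ~~ @nf R w2 w3 k' x' y'.
  apply: affine_equiv_trans (affine_equiv_sym (rep_equiv_nf R _ _ _ _ _)) _.
  exact: affine_equiv_trans eqr (rep_equiv_nf R _ _ _ _ _).
suff [-> -> ->] : [/\ k = k', x = x' & y = y'] by [].
have [w2_gt1|w2_le1] := ltP 1 w2.
  have w2w3 : 1 < w2 <= w3 by lia.
  have [ht hc] := equiv_congr_tet w2w3 (nf_reduced hw hv : reduced _ (w2, x).1 (w2, x).2 _ _ _ _) eqnf.
  have [lt|le] := ltP w2 w3; first by apply: (@nf_unique_lt w2 w3) => //; lia.
  have w3E : w3 = w2 by lia.
  by rewrite w3E in hv hv' hc; apply: (@nf_unique_eq w2) => //; lia.
have w2E : w2 = 1 by lia.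
(* The normalised volumes are [w3] for [k = 0], and [2 w3 - 1] or [2 w3] for [k = 3]. *)
have volnf : `|cross (w2, x) (nf_snd w2 w3 k x y)| = `|cross (w2, x') (nf_snd w2 w3 k' x' y')|.
  rewrite -(vol_tet (nf_triangular k)) -(vol_tet (nf_triangular k')); apply: vol_equiv eqnf.
  by rewrite -normr_gt0 vol_tet normr_gt0; exact: cross_nf.
have bit (z : int) : 0 <= z <= 1 -> z = 0 \/ z = 1 by lia.
have w2_gt0 : 0 < w2 by lia.
have [xE _] := nf_fst_range w2_gt0 hv; have [x'E _] := nf_fst_range w2_gt0 hv'.
move: hv hk hv' hk' volnf xE x'E; rewrite {}w2E /cross => hv hk hv' hk' volnf /bit xE /bit x'E.
clear eqr eqnf; case: xE hv volnf => ->; case: x'E hv' => ->; move: hk hk'.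
all: case: k => [|[|[|[|[|//]]]]]; case: k' => [|[|[|[|[|//]]]]] //=; rewrite ?modz1 => *; split; lia.
Qed.

(** A second functional of width one exists here: one minus the sum of the first two coordinates
    vanishes at three of the vertices, so the tetrahedron is also a pyramid over a triangle. *)
Lemma flat_rectangle_pyramid w3 : @nf R 1 w3 2 0 0 ~~ @nf R 1 w3 0 0 0.
Proof.
rewrite /nf /tet /=.
have -> : lhull R (vs (pt 0 0 0) (pt 0 1 0) (pt 0 0 w3) (pt 1 0 0)) =
    lhull R (vs (pt 1 0 0) (pt 0 1 0) (pt 0 0 0) (pt 0 0 w3)).
  by rewrite lhull_swap23 lhull_swap12 lhull_swap01 lhull_swap12.
apply: (@affine_equiv_pts R (-1) (-1) 0 0 1 0 0 0 1 1 0 0) => //.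
all: by rewrite mx3_pt ptD; congr pt; ring.
Qed.

Lemma mwidth_rep w2 w3 P : 0 < w2 <= w3 ->
  lattice_tetrahedron P -> is_mwidth P [tuple 1; w2%:~R; w3%:~R] ->
  exists2 p, rep_valid w2 w3 p & rep w2 w3 p.1.1 p.1.2 p.2 ~~ P.
Proof.
move=> hw latP mwP; have [t [u [v [Puv red]]]] := mwidth1_equiv_reduced latP mwP.
have [k [x [y [hv uvE]]]] := reduced_normal_form R hw red.
have Pnf := affine_equiv_sym (affine_equiv_trans Puv uvE).
have [hk|] := boolP ((1 < w2) || (k != 2%N)).
  exists (k, x, y); first by rewrite /rep_valid /= hv.
  exact: affine_equiv_trans (rep_equiv_nf R _ _ _ _ _) Pnf.
rewrite negb_or negbK => /andP[w2_le1 /eqP kE].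
have w2E : w2 = 1 by lia.
have [xE yE] : x = 0 /\ y = 0 by move: hv; rewrite kE w2E /=; clear; lia.
exists (0%N, 0, 0); first by rewrite /rep_valid w2E /= modz1.
rewrite kE xE yE w2E in Pnf; rewrite w2E.
apply: affine_equiv_trans (rep_equiv_nf R _ _ _ _ _) _.
exact: affine_equiv_trans (affine_equiv_sym (flat_rectangle_pyramid w3)) Pnf.
Qed.

Lemma tetrahedra_bij (w2 w3 : nat) : (1 <= w2 <= w3)%N ->
  set_bij (tetrahedra R w2 w3) (tetrahedron_classes R w2 w3) (@affine_class R 3).
Proof.
move=> hw; have hwz : 0 < w2%:Z <= w3%:Z by lia.
rewrite tetrahedra_rep //; split.
- move=> _ [p /= /andP[hv _] <-].
  by exists (rep w2 w3 p.1.1 p.1.2 p.2) => //; exact: (rep_lattice_mwidth hwz hv).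
- move=> _ _ /set_mem[p /= hp <-] /set_mem[q /= hq <-] /affine_class_eqP.
  by move/(rep_equiv_inj hwz hp hq) => ->.
- move=> _ [P [latP mwP] <-]; have [p hp eqp] := mwidth_rep hwz latP mwP.
  exists (rep w2 w3 p.1.1 p.1.2 p.2); first by exists p.
  exact/affine_class_eqP.
Qed.

Lemma tetrahedron_classes_card (w2 w3 : nat) : (1 <= w2 <= w3)%N ->
  (tetrahedron_classes R w2 w3 #= [set p | rep_valid w2 w3 p])%card.
Proof.
move=> hw; have hwz : 0 < w2%:Z <= w3%:Z by lia.
rewrite -(card_eqr (_ : tetrahedra R w2 w3 #= _)%card).
  rewrite card_eq_sym; apply/card_set_bijP.
  by exists (@affine_class R 3); exact: tetrahedra_bij.
rewrite tetrahedra_rep //.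
apply: inj_card_eq => p q /set_mem hp /set_mem hq pq.
apply: (rep_equiv_inj hwz hp hq); rewrite pq; exact: affine_equiv_refl.
Qed.

End Classification.

(** * Counting *)

Section Counting.

Lemma card_uniq_seq (T : choiceType) (s : seq T) : uniq s ->
  ([set x | x \in s] #= `I_(size s))%card.
Proof.
move=> us; apply/card_set_bijP; exists (index^~ s); split.
- by move=> x /= xs; rewrite index_mem.
- by move=> x y /set_mem /= xs /set_mem /= ys /(congr1 (nth x s)); rewrite !nth_index.
- move=> i /= ilt; case: s us ilt => // x0 s us ilt.
  by exists (nth x0 (x0 :: s) i); [exact: mem_nth|rewrite index_uniq].
Qed.

Local Open Scope nat_scope.

Definition block (k m n : nat) (f g : nat -> nat) : seq (nat * int * int) :=
  [seq (k, x%:Z, y%:Z) | x <- iota m n, y <- iota (f x) (g x)].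



Lemma mem_block k m n f g k' (x y : int) :
  reflect (exists i j : nat, [/\ k' = k, x = i, y = j, m <= i < m + n & f i <= j < f i + g i])
    ((k', x, y) \in block k m n f g).
Proof.
apply: (iffP allpairsPdep) => [[i [j [hi hj [-> -> ->]]]]|[i [j [-> -> -> hi hj]]]].
  by exists i, j; split => //; rewrite -mem_iota.
by exists i, j; split => //; rewrite mem_iota.
Qed.

Lemma block_uniq k m n f g : uniq (block k m n f g).
Proof.
apply: allpairs_uniq_dep => [|i _|]; rewrite ?iota_uniq //.
by move=> [i j] [i' j'] _ _ /= [-> ->].
Qed.

Lemma size_block k m n f g : size (block k m n f g) = \sum_(m <= i < m + n) g i.
Proof.
rewrite size_allpairs_dep sumnE big_map /index_iota addKn.
by apply: eq_bigr => i _; rewrite size_iota.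
Qed.

Lemma cat_block_uniq k m n f g s : uniq s ->
  (forall p, p \in block k m n f g -> p \in s -> False) -> uniq (block k m n f g ++ s).
Proof.
move=> us dis; rewrite cat_uniq block_uniq us andbT /=.
by apply/hasPn => p ps; apply/negP => pb; exact: (dis p pb ps).
Qed.

(** Like the next two sums, the closed form is cleared of division and spread over both sides, so
    that the value of the sum needs no truncated subtraction. *)
Lemma sum_ascending m n c : c <= m ->
  2 * (\sum_(m <= i < m + n) (i - c)) + 2 * n * c + n = n * (2 * m + n).
Proof.
move=> cm; elim: n => [|n IH]; first by rewrite addn0 big_geq; lia.
by rewrite (addnS m n) big_nat_recr /=; nia.
Qed.

Lemma sum_descending m n c : m + n <= c + 1 ->
  2 * (\sum_(m <= i < m + n) (c - i)) + n * (2 * m + n) = n * (2 * c + 1).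
Proof.
elim: n => [|n IH] cm; first by rewrite addn0 big_geq; lia.
have {}IH := IH (ltac:(lia)).
by rewrite (addnS _ n) big_nat_recr /=; nia.
Qed.

Lemma sum_descending2 n c : 2 * n <= c ->
  \sum_(1 <= i < 1 + n) (c - 2 * i) + n * (n + 1) = n * c.
Proof.
elim: n => [|n IH] cm; first by rewrite addn0 big_geq; lia.
have {}IH := IH (ltac:(lia)).
by rewrite (addnS _ n) big_nat_recr /=; nia.
Qed.

(** With [r] the residue of [b], that of [b - y] is [r - y] up to [y = r] and [a + r - y] up to
    [y = a + r]; beyond that [y] exceeds every residue. *)
Lemma axis_mod (a b y : int) : (0 < a)%R -> (0 <= y)%R ->
  (y <= ((b - y) %% a)%Z)%R =
  (2 * y <= (b %% a)%Z)%R || ((b %% a)%Z < y)%R && (2 * y <= a + (b %% a)%Z)%R.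
Proof.
move=> a0 y0; have an0 : a != 0%R by lia.
have := divz_eq b a; have := modz_ge0 b an0; have := ltz_pmod b a0.
move: (b %/ a)%Z (b %% a)%Z => q r ra r0 ->.
rewrite -addrA modzMDl.
have [yr|ry] := leP y r; first by rewrite modz_small; lia.
have [ya|ay] := leP y (a + r)%R; last first.
  have := @ltz_pmod (r - y)%R a a0; lia.
by rewrite (_ : (r - y = (-1) * a + (a + r - y))%R); [rewrite modzMDl modz_small; lia|ring].
Qed.

(** The first two blocks are the two ranges of [axis_mod] for [x = 0]. *)
Definition reps_lt (a b : nat) : seq (nat * int * int) :=
  let r := b %% a in
  block 0 0 1 (fun=> 0) (fun=> r./2.+1) ++
  block 0 0 1 (fun=> r.+1) (fun=> (a + r)./2 - r) ++
  block 0 1 a./2 (fun=> 0) (fun x => a.+1 - x) ++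
  block 1 1 a.-1./2 (fun=> 1) (fun x => x - 1) ++
  block 2 0 1 (fun=> 0) (fun=> a./2.+1) ++
  block 3 1 a (fun=> b - a) (fun=> a.+1) ++
  block 4 1 a.-1 (fun=> 1) (fun x => x - 1).

(** For [k = 4] the bounds [y < x] and [y <= a - x] compete; the first is the stronger one exactly
    when [2 x <= a + 1], hence the two blocks. The family [k = 1] is empty. *)
Definition reps_eq (a : nat) : seq (nat * int * int) :=
  block 0 0 1 (fun=> 0) (fun=> a./2.+1) ++
  block 0 1 a./2 id (fun x => a.+1 - 2 * x) ++
  block 2 0 1 (fun=> 0) (fun=> a./2.+1) ++
  block 3 1 a id (fun x => a.+1 - x) ++
  block 4 1 a.+1./2 (fun=> 1) (fun x => x - 1) ++
  block 4 a.+1./2.+1 (a.-1 - a.+1./2) (fun=> 1) (fun x => a - x).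

Lemma mem_reps_lt a b p : 1 < a < b -> (p \in reps_lt a b) = rep_valid a b p.
Proof.
move=> hab; case: p => [[k x] y]; rewrite /reps_lt !(mem_cat _ (block _ _ _ _ _)).
have ra : b %% a < a by rewrite ltn_pmod; lia.
have rE : (b%:Z %% a%:Z)%Z = (b %% a)%N by rewrite modz_nat.
have -> : rep_valid a b (k, x, y) = nf_valid a b k x y.
  by rewrite /rep_valid /= (_ : (1 < a%:Z)%R = true) ?andbT //; lia.
apply/idP/idP.
  move=> h; have a0 : (0 < a%:Z)%R by lia.
  have axis z : (0 <= z)%R -> (z <= ((b%:Z - z) %% a%:Z)%Z)%R =
     (2 * z <= (b %% a)%N%:Z)%R || ((b %% a)%N%:Z < z)%R && (2 * z <= a%:Z + (b %% a)%N%:Z)%R.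
    by move=> z0; rewrite (axis_mod _ a0 z0) rE.
  move: (b %% a) ra rE axis h => r ra _ axis.
  case/or4P => [|||/or4P[]] /mem_block[i [j [-> -> -> hi hj]]].
  - have -> : i = 0%N by lia.
    by change ((0 <= j%:Z)%R && (j%:Z <= ((b%:Z - j%:Z) %% a%:Z)%Z)%R); rewrite axis; lia.
  - have -> : i = 0%N by lia.
    by change ((0 <= j%:Z)%R && (j%:Z <= ((b%:Z - j%:Z) %% a%:Z)%Z)%R); rewrite axis; lia.
  - by rewrite /=; case: eqVneq => ?; lia.
  - rewrite /=; lia.
  - rewrite /=; lia.
  - rewrite /=; lia.
  - rewrite /=; lia.
have nn (z : int) : (0 <= z)%R -> z = `|z|%N by lia.
case: k => [|[|[|[|[|//]]]]] /=.
- case: eqVneq => [->|xn0] h.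
    have a0 : (0 < a%:Z)%R by lia.
    have y0 : (0 <= y)%R by lia.
    move: h; rewrite (axis_mod _ a0 y0) rE y0 /= => /orP[h|h].
      by apply/or4P; constructor 1; apply/mem_block; exists 0%N, `|y|%N; split; lia.
    by apply/or4P; constructor 2; apply/mem_block; exists 0%N, `|y|%N; split; lia.
  by apply/or4P; constructor 3; apply/mem_block; exists `|x|%N, `|y|%N; split; lia.
- move=> h; apply/or4P; constructor 4; apply/or4P; constructor 1.
  by apply/mem_block; exists `|x|%N, `|y|%N; split; lia.
- move=> h; apply/or4P; constructor 4; apply/or4P; constructor 2.
  by apply/mem_block; exists `|x|%N, `|y|%N; split; lia.
- move=> h; apply/or4P; constructor 4; apply/or4P; constructor 3.
  by apply/mem_block; exists `|x|%N, `|y|%N; split; lia.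
- move=> h; apply/or4P; constructor 4; apply/or4P; constructor 4.
  by apply/mem_block; exists `|x|%N, `|y|%N; split; lia.
Qed.

Lemma mem_reps_eq a p : 1 < a -> (p \in reps_eq a) = rep_valid a a p.
Proof.
move=> ha; case: p => [[k x] y]; rewrite /reps_eq !(mem_cat _ (block _ _ _ _ _)).
have -> : rep_valid a a (k, x, y) = nf_valid a a k x y.
  by rewrite /rep_valid /= (_ : (1 < a%:Z)%R = true) ?andbT //; lia.
have a0 : (0 < a%:Z)%R by lia.
have axis z : (0 <= z)%R -> (z <= ((a%:Z - z) %% a%:Z)%Z)%R = (2 * z <= a)%R.
  by move=> z0; rewrite (axis_mod _ a0 z0) modzz; lia.
apply/idP/idP.
  case/or4P => [|||/or3P[]] /mem_block[i [j [-> -> -> hi hj]]].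
  - have -> : i = 0%N by lia.
    by change ((0 <= j%:Z)%R && (j%:Z <= ((a%:Z - j%:Z) %% a%:Z)%Z)%R); rewrite axis; lia.
  - by rewrite /=; case: eqVneq => ?; lia.
  - rewrite /=; lia.
  - rewrite /=; lia.
  - rewrite /=; lia.
  - rewrite /=; lia.
case: k => [|[|[|[|[|//]]]]] /=; try lia.
- case: eqVneq => [->|xn0] h.
    have y0 : (0 <= y)%R by lia.
    move: h; rewrite axis // y0 /= => h.
    by apply/or4P; constructor 1; apply/mem_block; exists 0%N, `|y|%N; split; lia.
  by apply/or4P; constructor 2; apply/mem_block; exists `|x|%N, `|y|%N; split; lia.
- move=> h; apply/or4P; constructor 3.
  by apply/mem_block; exists `|x|%N, `|y|%N; split; lia.
- move=> h; apply/or4P; constructor 4; apply/or3P; constructor 1.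
  by apply/mem_block; exists `|x|%N, `|y|%N; split; lia.
- move=> h; apply/or4P; constructor 4; apply/or3P.
  have [xa|ax] := leqP `|x|%N a.+1./2.
    by constructor 2; apply/mem_block; exists `|x|%N, `|y|%N; split; lia.
  by constructor 3; apply/mem_block; exists `|x|%N, `|y|%N; split; lia.
Qed.

Ltac block_disjoint :=
  let not_in_block := move=> /mem_block[? [? [? ? ? ? ?]]]; lia in
  move=> [[? ?] ?] /mem_block[? [? [-> -> -> ? ?]]];
  do ?rewrite (mem_cat _ (block _ _ _ _ _));
  repeat match goal with
  | |- is_true (_ || _) -> _ => case/orP; first by not_in_block
  end; not_in_block.

Lemma reps_lt_uniq a b : uniq (reps_lt a b).
Proof.
rewrite /reps_lt; do 6!(apply: cat_block_uniq; last by block_disjoint).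
exact: block_uniq.
Qed.

Lemma reps_eq_uniq a : uniq (reps_eq a).
Proof.
rewrite /reps_eq; do 5!(apply: cat_block_uniq; last by block_disjoint).
exact: block_uniq.
Qed.

Lemma size_reps_lt a b : 1 < a < b -> size (reps_lt a b) =
  if odd a then 2 * a ^ 2 + 2 else if odd b then 2 * a ^ 2 + 3 else 2 * a ^ 2 + 4.
Proof.
move=> hab; rewrite /reps_lt !(size_cat (block _ _ _ _ _)) !size_block.
rewrite !add0n !big_nat1 sum_nat_const_nat addKn.
have ra : b %% a < a by rewrite ltn_pmod; lia.
(* For odd [a] the first two blocks have [(a + 1) / 2] elements whatever [r] is. For even [a] they
   have [a / 2 + 1] or [a / 2] as [r] is even or odd, and [r] then has the parity of [b]. *)
have rb : ~~ odd a -> odd (b %% a) = odd b.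
  by move=> oa; rewrite {2}(divn_eq b a) oddD oddM (negPf oa) andbF.
move: (b %% a) ra rb => r ra rb.
have s3 := @sum_descending 1 a./2 a.+1 (ltac:(lia)).
have s4 := @sum_ascending 1 a.-1./2 1 isT.
have s7 := @sum_ascending 1 a.-1 1 isT.
move: (\sum_(_ <= i < _) (a.+1 - i)) s3 => S3 s3.
move: (\sum_(_ <= i < 1 + a.-1./2) (i - 1)) s4 => S4 s4.
move: (\sum_(_ <= i < 1 + a.-1) (i - 1)) s7 => S7 s7.
rewrite -mulnn; have aE := odd_double_half a.
have [h [ah oh]] : exists h, a = h.*2 + odd a /\ a./2 = h by exists a./2; lia.
move: rb; rewrite oh in s3 *; case: (odd a) ah {aE} => ah rb.
  have ah1 : a.-1 = h.*2 by lia.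
  have ah2 : a.-1./2 = h by lia.
  move: s3 s4 s7; rewrite ah2 ah1; clear rb hab ah1 ah2 oh; subst a => s3 s4 s7.
  lia.
have ah1 : a.-1./2 = h.-1 by lia.
have h0 : 0 < h by lia.
move: s3 s4 s7; rewrite ah1 -{}rb //; clear hab ah1 oh; rewrite addn0 in ah; subst a.
case: h h0 ra => // h _ ra; rewrite /= doubleS /= => s3 s4 s7.
have rE := odd_double_half r; case: (odd r) rE => rE; lia.
Qed.

Lemma size_reps_eq a : 1 < a -> size (reps_eq a) =
  if odd a then a ^ 2 + a + 1 else a ^ 2 + a + 2.
Proof.
move=> ha; rewrite /reps_eq !(size_cat (block _ _ _ _ _)) !size_block !add0n !big_nat1.
have s2 := @sum_descending2 a./2 a.+1 (ltac:(lia)).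
have s4 := @sum_descending 1 a a.+1 (ltac:(lia)).
have s5 := @sum_ascending 1 a.+1./2 1 isT.
have s6 := @sum_descending a.+1./2.+1 (a.-1 - a.+1./2) a (ltac:(lia)).
move: (\sum_(_ <= i < _) (a.+1 - 2 * i)) s2 => S2 s2.
move: (\sum_(_ <= i < _) (a.+1 - i)) s4 => S4 s4.
move: (\sum_(_ <= i < _) (i - 1)) s5 => S5 s5.
move: (\sum_(_ <= i < _) (a - i)) s6 => S6 s6.
rewrite -mulnn; have aE := odd_double_half a.
have [h [ah oh]] : exists h, a = h.*2 + odd a /\ a./2 = h by exists a./2; lia.
rewrite oh in s2 *; case: (odd a) ah {aE} => ah.
  have ah1 : a.+1./2 = h.+1 by lia.
  have ah2 : a.-1 - h.+1 = h.-1 by lia.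
  move: s2 s4 s5 s6; rewrite ah1 ah2; have h0 : 0 < h by lia.
  clear ah1 ah2 oh ha; subst a; case: h h0 => // h _ /= => s2 s4 s5 s6; lia.
have ah1 : a.+1./2 = h by lia.
have ah2 : a.-1 - h = h.-1 by lia.
move: s2 s4 s5 s6; rewrite ah1 ah2; have h0 : 0 < h by lia.
clear ah1 ah2 oh ha; rewrite addn0 in ah; subst a; case: h h0 => // h _ /= => s2 s4 s5 s6; lia.
Qed.

Local Open Scope card_scope.

Lemma card_rep_valid_lt a b : 1 < a < b ->
  [set p | rep_valid a b p] #= `I_(if odd a then 2 * a ^ 2 + 2
    else if odd b then 2 * a ^ 2 + 3 else 2 * a ^ 2 + 4).
Proof.
move=> hab; rewrite -(size_reps_lt hab).
have -> : [set p | rep_valid a b p] = [set p | p \in reps_lt a b].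
  by apply/seteqP; split=> p /=; rewrite mem_reps_lt.
exact/card_uniq_seq/reps_lt_uniq.
Qed.

Lemma card_rep_valid_eq a : 1 < a ->
  [set p | rep_valid a a p] #= `I_(if odd a then a ^ 2 + a + 1 else a ^ 2 + a + 2).
Proof.
move=> ha; rewrite -(size_reps_eq ha).
have -> : [set p | rep_valid a a p] = [set p | p \in reps_eq a].
  by apply/seteqP; split=> p /=; rewrite mem_reps_eq.
exact/card_uniq_seq/reps_eq_uniq.
Qed.

Lemma rep_valid1 (b : nat) k (x y : int) : 0 < b -> rep_valid 1 b (k, x, y) =
  ((k, x, y) \in ((0, 0%:Z, 0%:Z) :: (3, 1%:Z, b%:Z) ::
    if 1 < b then [:: (3, 1%:Z, b.-1%:Z)] else [::])).
Proof.
move=> b0; rewrite /rep_valid /=; have [b1|b1] := ltnP 1 b; rewrite !inE !xpair_eqE.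
  case: k => [|[|[|[|[|k]]]]] /=; rewrite ?modz1 ?andbF //; last first; try lia.
  by case: eqVneq; lia.
case: k => [|[|[|[|[|k]]]]] /=; rewrite ?modz1 ?andbF //; last first; try lia.
by case: eqVneq; lia.
Qed.

Lemma card_rep_valid1 b : 0 < b -> [set p | rep_valid 1 b p] #= `I_(if 1 < b then 3 else 2).
Proof.
move=> b0; pose s : seq (nat * int * int) := (0, 0%:Z, 0%:Z) :: (3, 1%:Z, b%:Z) ::
  if 1 < b then [:: (3, 1%:Z, b.-1%:Z)] else [::].
have -> : [set p | rep_valid 1 b p] = [set p | p \in s].
  by apply/seteqP; split=> -[[k x] y] /=; rewrite rep_valid1.
have -> : (if 1 < b then 3 else 2) = size s by rewrite /s; case: ifP.
apply: card_uniq_seq; rewrite /s; case: ltnP => //= b1.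
by rewrite !inE !xpair_eqE /=; lia.
Qed.

End Counting.

Local Open Scope card_scope.

Theorem theorem1p1 (R : realType) (w2 w3 : nat) (hw2 : (1 <= w2)%N)
    (hw23 : (w2 <= w3)%N) :
  set_bij (tetrahedra R (Posz w2) (Posz w3)) (tetrahedron_classes R w2 w3)
    (@affine_class R 3) /\
  ((1 < w2)%N -> (w2 < w3)%N ->
    tetrahedron_classes R w2 w3 #=
      `I_(if odd w2 then 2 * w2 ^ 2 + 2
          else if odd w3 then 2 * w2 ^ 2 + 3
          else 2 * w2 ^ 2 + 4)%N) /\
  ((1 < w2)%N -> w3 = w2 ->
    tetrahedron_classes R w2 w3 #=
      `I_(if odd w2 then w2 ^ 2 + w2 + 1 else w2 ^ 2 + w2 + 2)%N) /\
  (w2 = 1%N -> (1 < w3)%N -> tetrahedron_classes R w2 w3 #= `I_3) /\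
  (w2 = 1%N -> w3 = 1%N -> tetrahedron_classes R w2 w3 #= `I_2).
Proof.
have hw : (1 <= w2 <= w3)%N by rewrite hw2 hw23.
have cardE := tetrahedron_classes_card R hw.
split; [exact: tetrahedra_bij|split; [|split; [|split]]].
- move=> w2_gt1 w23; rewrite (card_eql cardE); apply: card_rep_valid_lt.
  by rewrite w2_gt1.
- by move=> w2_gt1 w3E; rewrite (card_eql cardE) w3E; exact: card_rep_valid_eq.
- move=> w2E w3_gt1; rewrite (card_eql cardE) w2E.
  by have := card_rep_valid1 (ltnW w3_gt1); rewrite w3_gt1.
- move=> w2E w3E; rewrite (card_eql cardE) w2E w3E.
  exact: (@card_rep_valid1 1).
Qed.
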